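(* Let $n\ge 1$, let $\boldsymbol{L}\in\mathbb{R}^{n\times n}$ be Hurwitz, and for $m=1,\dots,n$ let $\boldsymbol{R}_m\in\mathbb{R}^{n\times n}$ be symmetric. Define $\boldsymbol{\Upsilon}:\mathbb{R}^n\to\mathbb{R}^n$ by $\Upsilon_m(\boldsymbol{a})=\boldsymbol{a}^T\boldsymbol{R}_m\boldsymbol{a}$, and assume $\boldsymbol{a}^T\boldsymbol{\Upsilon}(\boldsymbol{a})=0$ for all $\boldsymbol{a}\in\mathbb{R}^n$. Let $\boldsymbol{n}\in\mathbb{R}^n$ be a fixed vector with $\boldsymbol{n}^T\boldsymbol{\Upsilon}(\boldsymbol{a})=0$ for all $\boldsymbol{a}$, and set $\boldsymbol{M}_0:=\boldsymbol{I}$, $\boldsymbol{M}_i:=\boldsymbol{e}_i\boldsymbol{n}^T$ ($i=1,\dots,n$), $\boldsymbol{T}_j:=\boldsymbol{e}_j\boldsymbol{n}^T+\boldsymbol{n}\boldsymbol{e}_j^T$ ($j=1,\dots,n$), where $\boldsymbol{e}_k$ is the $k$-th standard unit vector. Consider the input-output system $$\dot{\boldsymbol{a}}=\boldsymbol{L}\boldsymbol{a}+\boldsymbol{\Upsilon}(\boldsymbol{a})+\boldsymbol{f}(t),\qquad \boldsymbol{y}=\boldsymbol{a},\qquad \boldsymbol{a}(0)=\boldsymbol{a}_0,$$ with input $\boldsymbol{f}:[0,\infty)\to\mathbb{R}^n$. Let $\delta>0$. Suppose there exist a symmetric matrix $\boldsymbol{P}\in\mathbb{R}^{n\times n}$,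 a scalar $\varepsilon>0$, scalars $s_1,\dots,s_n\ge 0$, and real scalars $\mu_0,\dots,\mu_n$, $\kappa_1,\dots,\kappa_n$ such that $\boldsymbol{P}-\varepsilon\boldsymbol{I}\succeq 0$ and $\boldsymbol{G}\preceq 0$, where $$\boldsymbol{G}:=\begin{bmatrix}\boldsymbol{L}^T\boldsymbol{P}+\boldsymbol{P}\boldsymbol{L}+\varepsilon\boldsymbol{I}+\sum_{m=1}^n s_m\delta^2\boldsymbol{R}_m\boldsymbol{R}_m & \boldsymbol{P}+\sum_{i=0}^n\mu_i\boldsymbol{M}_i\\ \boldsymbol{P}+\sum_{i=0}^n\mu_i\boldsymbol{M}_i^T & -\sum_{m=1}^n s_m\boldsymbol{e}_m\boldsymbol{e}_m^T+\sum_{j=1}^n\kappa_j\boldsymbol{T}_j\end{bmatrix}.$$ Let $\lambda_{\min}(\boldsymbol{P}),\lambda_{\max}(\boldsymbol{P})$ be the extreme eigenvalues of $\boldsymbol{P}$ and $\|2\boldsymbol{P}\|$ the spectral norm of $2\boldsymbol{P}$. Then for each $\boldsymbol{a}_0$ with $\|\boldsymbol{a}_0\|\le\delta\sqrt{\lambda_{\min}(\boldsymbol{P})/\lambda_{\max}(\boldsymbol{P})}$ the system is small-signal finite-gain $\mathcal{L}_p$ stable for each $p\in[1,\infty]$. In particular, for each $\tau\ge0$ and each $\boldsymbol{f}\in\mathcal{L}_{pe}$ with $$\sup_{0\le t\le\tau}\|\boldsymbol{f}(t)\|\le \frac{\lambda_{\min}(\boldsymbol{P})\,\varepsilon\,\delta}{\lambda_{\max}(\boldsymbol{P})\,\|2\boldsymbol{P}\|},$$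 the state satisfies $\|\boldsymbol{a}(t)\|\le\delta$ for all $t\in[0,\tau]$ and the output satisfies $\|\boldsymbol{y}_\tau\|_{\mathcal{L}_p}\le\gamma\|\boldsymbol{f}_\tau\|_{\mathcal{L}_p}+\beta$, where $$\gamma=\frac{\lambda_{\max}(\boldsymbol{P})\|2\boldsymbol{P}\|}{\lambda_{\min}(\boldsymbol{P})\,\varepsilon},\qquad \beta=\|\boldsymbol{a}_0\|\sqrt{\frac{\lambda_{\max}(\boldsymbol{P})}{\lambda_{\min}(\boldsymbol{P})}}\,\rho,\qquad \rho=\begin{cases}1,&p=\infty,\\ \left(\frac{2\lambda_{\max}(\boldsymbol{P})}{\varepsilon p}\right)^{1/p},&p\in[1,\infty).\end{cases}$$
   Context: $\|\cdot\|$ denotes the Euclidean norm on $\mathbb{R}^n$. For a signal $\boldsymbol{g}:[0,\infty)\to\mathbb{R}^n$ and $\tau\ge0$, the truncation is $\boldsymbol{g}_\tau(t)=\boldsymbol{g}(t)$ for $0\le t\le\tau$ and $\boldsymbol{g}_\tau(t)=\boldsymbol{0}$ for $t>\tau$. For $p\in[1,\infty)$, $\|\boldsymbol{g}\|_{\mathcal{L}_p}=(\int_0^\infty\|\boldsymbol{g}(t)\|^p\,dt)^{1/p}$, and $\|\boldsymbol{g}\|_{\mathcal{L}_\infty}=\sup_{t\ge0}\|\boldsymbol{g}(t)\|$. $\mathcal{L}_p$ is the set of piecewise continuous $\boldsymbol{g}:[0,\infty)\to\mathbb{R}^n$ with finite $\mathcal{L}_p$ norm, and the extended space is $\mathcal{L}_{pe}=\{\boldsymbol{g}:\boldsymbol{g}_\tau\in\mathcal{L}_p\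 \forall\tau\in[0,\infty)\}$. A matrix is Hurwitz if all its eigenvalues have negative real part. ''Small-signal finite-gain $\mathcal{L}_p$ stable'' means there exist constants $r>0$, $\gamma\ge0$, $\beta\ge0$ such that every input with $\sup_{0\le t\le\tau}\|\boldsymbol{f}(t)\|\le r$ yields $\|\boldsymbol{y}_\tau\|_{\mathcal{L}_p}\le\gamma\|\boldsymbol{f}_\tau\|_{\mathcal{L}_p}+\beta$; the explicit bounds are given in the claim. *)

(* Defs.v *)
From HB Require Import structures.
From mathcomp Require Import all_boot all_order all_algebra.
From mathcomp Require Import all_classical all_reals all_analysis.
From mathcomp Require Import complex.
Set Implicit Arguments. Unset Strict Implicit. Unset Printing Implicit Defensive.
Import Order.TTheory GRing.Theory Num.Theory.
Import numFieldNormedType.Exports.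
Local Open Scope classical_set_scope.
Local Open Scope ring_scope.

Section Defs.
Variable R : realType.

Definition enorm (k : nat) (x : 'cV[R]_k) : R := Num.sqrt (\sum_i x i 0 ^+ 2).

Definition dotv (k : nat) (u v : 'cV[R]_k) : R := (u^T *m v) 0 0.

Definition unitv (k : nat) (i : 'I_k) : 'cV[R]_k := delta_mx i 0.

Definition symmetric_mx (k : nat) (A : 'M[R]_k) : Prop := A^T = A.

Definition psd (k : nat) (A : 'M[R]_k) : Prop :=
  forall x : 'cV[R]_k, 0 <= (x^T *m A *m x) 0 0.
Definition nsd (k : nat) (A : 'M[R]_k) : Prop :=
  forall x : 'cV[R]_k, (x^T *m A *m x) 0 0 <= 0.

Definition hurwitz (k : nat) (A : 'M[R]_k) : Prop :=
  forall z : R[i], eigenvalue (map_mx (fun x : R => (x%:C)%C) A) z -> complex.Re z < 0.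

(* extreme (real) eigenvalues; for a symmetric matrix all eigenvalues are real *)
Definition lambda_min (k : nat) (A : 'M[R]_k) : R := inf [set x : R | eigenvalue A x].
Definition lambda_max (k : nat) (A : 'M[R]_k) : R := sup [set x : R | eigenvalue A x].

Definition spec_norm (k : nat) (A : 'M[R]_k) : R := Num.sqrt (lambda_max (A^T *m A)).

Definition trunc (k : nat) (tau : R) (g : R -> 'cV[R]_k) : R -> 'cV[R]_k :=
  fun t => if t <= tau then g t else 0.

Definition piecewise_continuous (k : nat) (g : R -> 'cV[R]_k) : Prop :=
  forall b : R, 0 < b -> exists s : seq R,
    (forall t, 0 < t < b -> t \notin s -> {for t, continuous g}) /\
    (forall t, 0 <= t < b -> cvg (g x @[x --> t^'+])) /\
    (forall t, 0 < t <= b -> cvg (g x @[x --> t^'-])).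

Definition Lp_norm (k : nat) (p : \bar R) (g : R -> 'cV[R]_k) : \bar R :=
  match p with
  | r%:E => ((\int[lebesgue_measure]_(t in `[0%R, +oo[%classic)
                ((enorm (g t)) `^ r)%:E) `^ r^-1)%E
  | +oo%E => ereal_sup [set (enorm (g t))%:E | t in `[0%R, +oo[%classic]
  | -oo%E => 0%E
  end.

Definition in_Lp (k : nat) (p : \bar R) (g : R -> 'cV[R]_k) : Prop :=
  piecewise_continuous g /\ (Lp_norm p g < +oo)%E.

Definition in_Lpe (k : nat) (p : \bar R) (g : R -> 'cV[R]_k) : Prop :=
  forall tau : R, 0 <= tau -> in_Lp p (trunc tau g).

Definition Ups (k : nat) (Rm : 'I_k -> 'M[R]_k) (a : 'cV[R]_k) : 'cV[R]_k :=
  \col_m (a^T *m Rm m *m a) 0 0.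

(* a solves  a' = L a + Ups(a) + f(t), a(0) = a0  on [0, tau]
   (in integral / Caratheodory sense, as f is only piecewise continuous) *)
Definition is_solution (k : nat) (L : 'M[R]_k) (Rm : 'I_k -> 'M[R]_k)
  (f : R -> 'cV[R]_k) (a0 : 'cV[R]_k) (tau : R) (a : R -> 'cV[R]_k) : Prop :=
  forall t : R, 0 <= t <= tau ->
    a t = a0 + \col_i (Rintegral lebesgue_measure `[0%R, t]%classic
                          (fun s => (L *m a s + Ups Rm (a s) + f s) i 0)).

Definition rho_const (p : \bar R) (lmax eps : R) : R :=
  match p with
  | r%:E => ((2 * lmax) / (eps * r)) `^ r^-1
  | _ => 1
  end.

End Defs.
Arguments unitv {R k}.

(* Main.v *)
(* With [V x = x^T P x], testing the matrix inequality on the vector (a, Ups a)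
   gives [V' <= -eps |a|^2 + |2P| |a| |f|] along trajectories, up to an error term
   that is nonpositive in the ball of radius [delta].  A Gronwall comparison shows
   that the sublevel set [V <= lambda_min delta^2] is invariant, so the trajectory
   stays in that ball.

   Solutions are only assumed to satisfy the integral equation, with [Rintegral]
   equal to 0 on non-integrable functions.  A primitive is always measurable, and a
   component whose integrand stops being integrable becomes constant; so the a
   priori bound propagates up to [tau], and the integrand is integrable on [0, tau].

   For finite p, multiplying the differential inequality of [U = sqrt (V + eta^2)]
   by [p U^(p-1)], integrating and applying Hoelder's inequality gives
   [X^p <= B^p + A X^(p-1)], hence [X <= A + B], for [X] the L_p norm of [U]; then
   eta tends to 0.  This avoids Young's convolution inequality. *)
Require Import Defs.
From HB Require Import structures.
From mathcomp Require Import all_boot all_order all_algebra.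
From mathcomp Require Import all_classical all_reals all_analysis.
From mathcomp Require Import complex measurable_realfun.
From mathcomp Require Import ring lra.
Import Order.TTheory GRing.Theory Num.Theory.
Import numFieldNormedType.Exports.
Local Open Scope classical_set_scope.
Local Open Scope ring_scope.

Set Implicit Arguments.
Unset Strict Implicit.
Unset Printing Implicit Defensive.

(** * Euclidean inner product and norm *)

Section Euclidean.
Context {R : realType} {n : nat}.
Implicit Types (u v w : 'cV[R]_n) (A : 'M[R]_n).

Lemma dotvE u v : dotv u v = \sum_i u i 0 * v i 0.
Proof. by rewrite /dotv mxE; apply: eq_bigr => i _; rewrite mxE. Qed.

Lemma dotvC u v : dotv u v = dotv v u.
Proof. by rewrite !dotvE; apply: eq_bigr => i _; rewrite mulrC. Qed.

Lemma dotvDr u v w : dotv u (v + w) = dotv u v + dotv u w.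
Proof. by rewrite /dotv mulmxDr mxE. Qed.

Lemma dotvZr (c : R) u v : dotv u (c *: v) = c * dotv u v.
Proof. by rewrite /dotv -scalemxAr mxE. Qed.

Lemma dotvDl u v w : dotv (v + w) u = dotv v u + dotv w u.
Proof. by rewrite dotvC dotvDr 2!(dotvC u). Qed.

Lemma dotvZl (c : R) u v : dotv (c *: u) v = c * dotv u v.
Proof. by rewrite dotvC dotvZr dotvC. Qed.

Lemma dotv_sumr (I : Type) (r : seq I) (Q : pred I) (F : I -> 'cV[R]_n) u :
  dotv u (\sum_(i <- r | Q i) F i) = \sum_(i <- r | Q i) dotv u (F i).
Proof. by rewrite /dotv mulmx_sumr summxE. Qed.

Lemma dotv_mulmxl A u v : dotv (A *m u) v = dotv u (A^T *m v).
Proof. by rewrite /dotv trmx_mul mulmxA. Qed.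

Lemma quad_dotv A u v : (u^T *m A *m v) 0 0 = dotv u (A *m v).
Proof. by rewrite /dotv mulmxA. Qed.

Lemma dotv_ge0 u : 0 <= dotv u u.
Proof. by rewrite dotvE sumr_ge0// => i _; rewrite -expr2 sqr_ge0. Qed.

Lemma dotv_eq0 u : dotv u u = 0 -> u = 0.
Proof.
rewrite dotvE => /eqP; rewrite psumr_eq0 => [/allP u0|i _]; last first.
  by rewrite -expr2 sqr_ge0.
apply/matrixP => i j; rewrite ord1 mxE; apply/eqP.
by have := u0 i (mem_index_enum _); rewrite /= -expr2 sqrf_eq0.
Qed.

Lemma enorm_ge0 u : 0 <= enorm u.
Proof. exact: sqrtr_ge0. Qed.

Lemma sqr_enorm u : enorm u ^+ 2 = dotv u u.
Proof.
rewrite sqr_sqrtr ?dotvE; last by rewrite sumr_ge0// => i _; rewrite sqr_ge0.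
by apply: eq_bigr => i _; rewrite expr2.
Qed.

Lemma enorm_le u (c : R) : 0 <= c -> (enorm u <= c) = (dotv u u <= c ^+ 2).
Proof. by move=> c0; rewrite -sqr_enorm ler_sqr// nnegrE enorm_ge0. Qed.

Lemma normr_coord_le_enorm u i : `|u i 0| <= enorm u.
Proof.
rewrite -ler_sqr ?nnegrE ?enorm_ge0// sqr_enorm real_normK ?num_real//.
rewrite dotvE (bigD1 i)//= -expr2 lerDl sumr_ge0// => j _.
by rewrite -expr2 sqr_ge0.
Qed.

Lemma sqr_dotv_le u v : dotv u v ^+ 2 <= dotv u u * dotv v v.
Proof.
have [v0|v0] := eqVneq (dotv v v) 0.
  have -> : dotv u v = 0 by rewrite (dotv_eq0 v0) /dotv mulmx0 mxE.
  by rewrite v0 mulr0 expr0n.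
have vp : 0 < dotv v v by rewrite lt_neqAle eq_sym v0 dotv_ge0.
rewrite -subr_ge0 -(pmulr_rge0 _ vp).
have := dotv_ge0 (dotv v v *: u + (- dotv u v) *: v).
rewrite !(dotvDr, dotvDl, dotvZl, dotvZr) (dotvC v u).
by lra.
Qed.

Lemma dotv_le_enorm u v : dotv u v <= enorm u * enorm v.
Proof.
apply: le_trans (ler_norm _) _.
rewrite -ler_sqr ?nnegrE ?mulr_ge0 ?enorm_ge0//.
by rewrite real_normK ?num_real// exprMn !sqr_enorm sqr_dotv_le.
Qed.

(** With [w = A v], the form at [v - t w] equals [-2 t |w|^2 + t^2 <w, A w>], which is negative for
    small [t > 0] unless [w = 0]. *)
Lemma psd_eq0 A v : symmetric_mx A -> psd A -> dotv v (A *m v) = 0 -> A *m v = 0.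
Proof.
move=> sA pA v0; apply: dotv_eq0; set w := A *m v.
have pos u : 0 <= dotv u (A *m u) by rewrite -quad_dotv; exact: pA.
have wv : dotv v (A *m w) = dotv w w by rewrite -[in LHS]sA -dotv_mulmxl.
have [//|N0] := eqVneq (dotv w w) 0.
have Np : 0 < dotv w w by rewrite lt_neqAle eq_sym N0 dotv_ge0.
have K0 := pos w; set K := dotv w (A *m w) in K0.
(* The [+ 1] keeps the denominator positive; [t K <= |w|^2] then makes the form at most
   [- t |w|^2]. *)
pose t := dotv w w / (K + 1).
have tp : 0 < t by rewrite divr_gt0// ltr_wpDl.
have tK : t * K <= dotv w w.
  by rewrite /t mulrAC ler_pdivrMr ?ltr_wpDl// ler_pM2l// lerDl.
have := pos (v + (- t) *: w).
rewrite mulmxDr -scalemxAr !(dotvDr, dotvDl, dotvZl, dotvZr) v0 wv -/w -/K.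
by nra.
Qed.

End Euclidean.

Lemma cvg_sumr (R : realType) (T I : Type) (F : set_system T)
    {FF : Filter F} (r : seq I)
    (f : I -> T -> R) (l : I -> R) :
  (forall i, f i x @[x --> F] --> l i) ->
  (\sum_(i <- r) f i x) @[x --> F] --> \sum_(i <- r) l i.
Proof.
move=> fl; elim: r => [|i r IH].
  by rewrite big_nil; under eq_fun do rewrite big_nil; exact: cvg_cst.
by rewrite big_cons; under eq_fun do rewrite big_cons; exact: cvgD.
Qed.

(** * Rayleigh quotients, extreme eigenvalues and the spectral norm *)

Section Rayleigh.
Context {R : realType} {n : nat}.
Implicit Types (A : 'M[R]_n).

Lemma continuous_rV_quad A : continuous (fun x : 'rV[R]_n => (x *m A *m x^T) 0 0).
Proof.
have -> : (fun x : 'rV[R]_n => (x *m A *m x^T) 0 0) =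
    (fun x => \sum_i (\sum_j x 0 j * A j i) * x 0 i).
  by apply/funext => x; rewrite !mxE; apply: eq_bigr => i _; rewrite !mxE.
move=> x; apply: (@cvg_sumr _ _ _ (nbhs x)) => i; apply: cvgM; last exact: coord_continuous.
by apply: (@cvg_sumr _ _ _ (nbhs x)) => j; apply: cvgMr_tmp; exact: coord_continuous.
Qed.

(** A maximizer [v] of the form on the unit sphere, with value [m], is isotropic for the positive
    semidefinite matrix [m I - A], hence lies in its kernel by [psd_eq0]. Compactness thus replaces
    the spectral theorem. *)
Lemma rayleigh_max A : (0 < n)%N -> symmetric_mx A ->
  exists2 m, eigenvalue A m & forall x, dotv x (A *m x) <= m * dotv x x.
Proof.
move=> n0 sA.
pose S := [set x : 'rV[R]_n | (x *m 1%:M *m x^T) 0 0 = 1].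
have SE (x : 'rV[R]_n) : (x *m 1%:M *m x^T) 0 0 = dotv x^T x^T.
  by rewrite mulmx1 /dotv trmxK.
have S0 : S !=set0.
  exists (delta_mx 0 (Ordinal n0)); rewrite /S/= mulmx1 mxE (bigD1 (Ordinal n0))//=.
  rewrite !mxE !eqxx mulr1 big1 ?addr0// => i /negbTE ni.
  by rewrite !mxE ni /= mul0r.
have cS : compact S.
  apply: bounded_closed_compact.
    exists 1; split; first exact: num_real.
    move=> M M1 x /= Sx; apply: le_trans (ltW M1).
    rewrite /Num.norm/= mx_normrE; apply/bigmax_leP; split => // -[i j] _ /=.
    rewrite ord1; have := normr_coord_le_enorm x^T j; rewrite mxE => /le_trans; apply.
    by rewrite enorm_le// -SE Sx expr1n.
  apply: (@preimage_closed _ _ (fun x : 'rV[R]_n => (x *m 1%:M *m x^T) 0 0) [set 1]).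
    by move=> x _; exact: continuous_rV_quad.
  exact: closed_eq.
have [|v] := EVT_max_rV S0 cS (f := fun x : 'rV[R]_n => (x *m A *m x^T) 0 0).
  exact/continuous_subspaceT/continuous_rV_quad.
rewrite inE /S/= => Sv vmax.
set m := (v *m A *m v^T) 0 0 in vmax.
have mE x : dotv x (A *m x) <= m * dotv x x.
  have [x0|x0] := eqVneq (dotv x x) 0.
    by rewrite (dotv_eq0 x0) /dotv !mulmx0 mxE mulr0.
  have xp : 0 < dotv x x by rewrite lt_neqAle eq_sym x0 dotv_ge0.
  pose c := Num.sqrt (dotv x x).
  have cp : 0 < c by rewrite sqrtr_gt0.
  have c2 : c ^+ 2 = dotv x x by rewrite sqr_sqrtr// ltW.
  have := vmax ((c^-1 *: x)^T).
  rewrite inE /S/= SE trmxK quad_dotv -scalemxAr !(dotvZl, dotvZr).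
  rewrite -c2 mulrA -invfM -expr2 mulVf ?gt_eqF ?exprn_gt0// => /(_ erefl).
  by rewrite mulrA -invfM -expr2 mulrC ler_pdivrMr ?exprn_gt0.
exists m => //.
have vv : dotv v^T v^T = 1 by rewrite -SE.
have Av : (m%:M - A) *m v^T = 0.
  apply: psd_eq0.
  - by rewrite /symmetric_mx raddfB/= tr_scalar_mx sA.
  - move=> x; rewrite quad_dotv mulmxBl mul_scalar_mx -scaleN1r dotvDr !dotvZr.
    by rewrite mulN1r subr_ge0 mE.
  - rewrite mulmxBl mul_scalar_mx -scaleN1r dotvDr !dotvZr vv /m.
    by rewrite mulN1r mulr1 -quad_dotv trmxK subrr.
apply/eigenvalueP; exists v; last first.
  apply/eqP => v0; move: Sv; rewrite v0 !mul0mx mxE => /esym/eqP.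
  by rewrite oner_eq0.
move/eqP: Av; rewrite mulmxBl mul_scalar_mx subr_eq0 => /eqP /(congr1 trmx).
by rewrite trmx_mul trmxK sA linearZ/= trmxK => ->.
Qed.

Lemma eigenvalue_cV A m : symmetric_mx A -> eigenvalue A m ->
  exists2 x : 'cV[R]_n, 0 < dotv x x & dotv x (A *m x) = m * dotv x x.
Proof.
move=> sA /eigenvalueP[v vA v0]; exists v^T; last first.
  rewrite -[in A *m _]sA -trmx_mul vA linearZ/= dotvZr//.
rewrite lt_neqAle dotv_ge0 andbT eq_sym; apply: contraNneq v0 => /dotv_eq0/(congr1 trmx).
by rewrite trmxK => ->; rewrite trmx0.
Qed.

(** [lambda_max] is a [sup], so the set of eigenvalues must be shown bounded: each one is a Rayleigh
    quotient, hence at most the maximum [m], which is itself an eigenvalue. *)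
Lemma dotv_le_lambda_max A : (0 < n)%N -> symmetric_mx A ->
  forall x, dotv x (A *m x) <= lambda_max A * dotv x x.
Proof.
move=> n0 sA x; have [m Am mE] := rayleigh_max n0 sA.
apply: le_trans (mE x) _; apply: ler_wpM2r; first exact: dotv_ge0.
apply: ub_le_sup => //; exists m => c /(eigenvalue_cV sA)[y y0 yE].
by rewrite -(ler_pM2r y0) -yE mE.
Qed.

Lemma rayleigh_min A : (0 < n)%N -> symmetric_mx A ->
  exists2 m, eigenvalue A m & forall x, m * dotv x x <= dotv x (A *m x).
Proof.
move=> n0 sA; have sNA : symmetric_mx (- A) by rewrite /symmetric_mx raddfN/= sA.
have [m /eigenvalueP[v vA v0] mE] := rayleigh_max n0 sNA; exists (- m).
  apply/eigenvalueP; exists v => //; apply: oppr_inj.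
  by rewrite -mulmxN vA scaleNr opprK.
by move=> x; have := mE x; rewrite mulNmx -scaleN1r dotvZr; lra.
Qed.

Lemma lambda_min_le_dotv A : (0 < n)%N -> symmetric_mx A ->
  forall x, lambda_min A * dotv x x <= dotv x (A *m x).
Proof.
move=> n0 sA x; have [m Am mE] := rayleigh_min n0 sA.
apply: le_trans (mE x); apply: ler_wpM2r; first exact: dotv_ge0.
apply: ge_inf => //; exists m => c /(eigenvalue_cV sA)[y y0 yE].
by rewrite -(ler_pM2r y0) -yE mE.
Qed.

Lemma lambda_min_ge A (eps : R) : (0 < n)%N -> symmetric_mx A ->
  psd (A - eps%:M) -> eps <= lambda_min A.
Proof.
move=> n0 sA pA; apply: lb_le_inf.
  by have [m Am _] := rayleigh_min n0 sA; exists m.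
move=> c /(eigenvalue_cV sA)[y y0 yE]; rewrite -(ler_pM2r y0) -yE.
have := pA y; rewrite quad_dotv mulmxBl mul_scalar_mx -scaleN1r dotvDr !dotvZr.
by lra.
Qed.

(** Since [|A x|^2 = <x, A^T A x>], the Rayleigh bound applies to [A^T A]. Its largest eigenvalue
    has to be nonnegative, because [Num.sqrt] is 0 on negative numbers. *)
Lemma enorm_mulmx_le A x : (0 < n)%N -> enorm (A *m x) <= spec_norm A * enorm x.
Proof.
move=> n0; have sAA : symmetric_mx (A^T *m A).
  by rewrite /symmetric_mx trmx_mul trmxK.
have le y := dotv_le_lambda_max n0 sAA y.
have Axx y : dotv y (A^T *m A *m y) = dotv (A *m y) (A *m y).
  by rewrite -mulmxA -dotv_mulmxl.
have l0 : 0 <= lambda_max (A^T *m A).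
  have [m Am _] := rayleigh_max n0 sAA.
  have [y y0 yE] := eigenvalue_cV sAA Am.
  by rewrite -(pmulr_lge0 _ y0); apply: le_trans (le y); rewrite Axx dotv_ge0.
rewrite enorm_le ?mulr_ge0 ?enorm_ge0 ?sqrtr_ge0//.
by rewrite exprMn sqr_enorm sqr_sqrtr// -Axx.
Qed.

End Rayleigh.

(** * The matrix inequality as a dissipation inequality *)

Section Lyapunov.
Context {R : realType} {n : nat}.
Variables (L : 'M[R]_n) (Rm : 'I_n -> 'M[R]_n) (nv : 'cV[R]_n) (delta : R).
Variables (P : 'M[R]_n) (eps : R) (s : 'I_n -> R).
Variables (mu0 : R) (mu kappa : 'I_n -> R).
Hypothesis n_gt0 : (0 < n)%N.
Hypothesis Rm_sym : forall m, symmetric_mx (Rm m).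
Hypothesis dotv_Ups : forall a, dotv a (Ups Rm a) = 0.
Hypothesis nv_Ups : forall a, dotv nv (Ups Rm a) = 0.
Hypothesis P_sym : symmetric_mx P.
Hypothesis s_ge0 : forall m, 0 <= s m.
Hypothesis G_nsd :
  nsd (block_mx
         (L^T *m P + P *m L + eps%:M
            + \sum_(m < n) (s m * delta ^+ 2) *: (Rm m *m Rm m))
         (P + mu0 *: 1%:M + \sum_(i < n) mu i *: (unitv i *m nv^T))
         (P + mu0 *: (1%:M)^T + \sum_(i < n) mu i *: (unitv i *m nv^T)^T)
         (- \sum_(m < n) s m *: (unitv m *m (unitv m)^T)
            + \sum_(j < n) kappa j *: (unitv j *m nv^T + nv *m (unitv j)^T))).

Lemma dotv_outer (u v x y : 'cV[R]_n) :
  dotv x ((u *m v^T) *m y) = dotv x u * dotv v y.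
Proof.
rewrite -mulmxA [v^T *m y]mx11_scalar -/(dotv v y) -scalemx1 -scalemxAr mulmx1.
by rewrite dotvZr mulrC.
Qed.

(** For symmetric [Rm], [delta ^ 2] times this is the quadratic form of the weighted sum of squares
    in the upper left block. *)
Definition Rm_energy (a : 'cV[R]_n) :=
  \sum_(m < n) s m * dotv (Rm m *m a) (Rm m *m a).

Lemma Rm_energy_ge0 a : 0 <= Rm_energy a.
Proof. by rewrite sumr_ge0// => m _; rewrite mulr_ge0 ?dotv_ge0. Qed.

(* The LMI tested on the vector (a, Ups a): the multiplier terms in mu and kappa
   vanish, and Cauchy-Schwarz bounds [Ups_m a ^ 2] by [|a|^2 |R_m a|^2]. *)
Lemma lyapunov_unforced (a : 'cV[R]_n) :
  2 * dotv a (P *m (L *m a + Ups Rm a)) <=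
  - eps * dotv a a + (dotv a a - delta ^+ 2) * Rm_energy a.
Proof.
set z := Ups Rm a.
have nz : dotv nv z = 0 := nv_Ups a.
have az : dotv a z = 0 := dotv_Ups a.
have := G_nsd (col_mx a z).
rewrite tr_col_mx -mulmxA mul_block_col mul_row_col mxE.
rewrite -/(dotv a _) -/(dotv z _).
have -> : dotv a ((L^T *m P + P *m L + eps%:M
            + \sum_(m < n) (s m * delta ^+ 2) *: (Rm m *m Rm m)) *m a
    + (P + mu0 *: 1%:M + \sum_(i < n) mu i *: (unitv i *m nv^T)) *m z) =
    2 * dotv a (P *m (L *m a)) + eps * dotv a a + delta ^+ 2 * Rm_energy a
    + dotv a (P *m z).
  rewrite dotvDr !mulmxDl !dotvDr !mulmx_suml !dotv_sumr.
  have -> : dotv a (L^T *m P *m a) = dotv a (P *m L *m a).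
    by rewrite -mulmxA -dotv_mulmxl dotvC dotv_mulmxl P_sym -mulmxA.
  rewrite mul_scalar_mx dotvZr -scalemxAl mul1mx dotvZr az mulr0 addr0.
  rewrite [X in _ + (_ + X)]big1 ?addr0; last first.
    by move=> i _; rewrite -scalemxAl dotvZr dotv_outer nz !mulr0.
  rewrite -!mulmxA; congr (_ + _ + _); first ring.
  rewrite /Rm_energy mulr_sumr; apply: eq_bigr => m _.
  rewrite -scalemxAl dotvZr -mulmxA dotv_mulmxl Rm_sym; ring.
have -> : dotv z ((P + mu0 *: (1%:M)^T + \sum_(i < n) mu i *: (unitv i *m nv^T)^T) *m a
    + (- \sum_(m < n) s m *: (unitv m *m (unitv m)^T)
            + \sum_(j < n) kappa j *: (unitv j *m nv^T + nv *m (unitv j)^T)) *m z) =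
    dotv a (P *m z) - \sum_m s m * z m 0 ^+ 2.
  rewrite dotvDr !mulmxDl !dotvDr !mulmx_suml mulNmx mulmx_suml !dotv_sumr.
  rewrite -scaleN1r dotvZr mulN1r dotv_sumr trmx1 -scalemxAl mul1mx dotvZr.
  rewrite (dotvC z a) az mulr0 addr0.
  rewrite [X in _ + X + _]big1 ?addr0; last first.
    move=> i _; rewrite -scalemxAl dotvZr trmx_mul trmxK dotv_outer.
    by rewrite (dotvC z) nz mul0r mulr0.
  rewrite [X in _ + (_ + X)]big1 ?addr0; last first.
    move=> i _; rewrite -scalemxAl dotvZr mulmxDl dotvDr !dotv_outer.
    by rewrite (dotvC z nv) nz mul0r mulr0 addr0 mulr0.
  rewrite dotvC dotv_mulmxl P_sym; congr (_ - _); apply: eq_bigr => m _.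
  rewrite -scalemxAl dotvZr dotv_outer (dotvC z); congr (_ * _).
  suff -> : dotv (unitv m) z = z m 0 by rewrite expr2.
  by rewrite /dotv /unitv trmx_delta -rowE mxE.
have zle : \sum_m s m * z m 0 ^+ 2 <= dotv a a * Rm_energy a.
  rewrite mulr_sumr; apply: ler_sum => m _.
  rewrite [leRHS]mulrCA; apply: ler_wpM2l => //.
  by rewrite /z mxE quad_dotv sqr_dotv_le.
rewrite mulmxDr dotvDr; lra.
Qed.

(** The input adds [2 <a, P f> = <2 P a, f>], bounded by Cauchy-Schwarz and the spectral norm. *)
Lemma lyapunov_forced (a f : 'cV[R]_n) :
  2 * dotv a (P *m (L *m a + Ups Rm a + f)) <=
  - eps * dotv a a + spec_norm (2 *: P) * enorm a * enorm f
  + (dotv a a - delta ^+ 2) * Rm_energy a.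
Proof.
rewrite mulmxDr dotvDr mulrDr addrAC; apply: lerD; first exact: lyapunov_unforced.
have -> : 2 * dotv a (P *m f) = dotv ((2 *: P) *m a) f.
  by rewrite -scalemxAl dotvZl dotv_mulmxl P_sym.
apply: le_trans (dotv_le_enorm _ _) _.
by apply: ler_wpM2r; rewrite ?enorm_ge0 ?enorm_mulmx_le.
Qed.

End Lyapunov.

(** * Scalar comparison principles *)

Section Comparison.
Context {R : realType}.
Implicit Types (H dH W dW : R -> R) (s : seq R).

(** The input is only piecewise continuous, so derivatives may fail to exist at finitely many
    points. Induction on their list: an interior one splits the interval, and with none left the
    mean value theorem concludes. *)
Lemma le0_derive_off_finite_le H dH s (x y : R) : x <= y ->
  {within `[x, y], continuous H} ->
  (forall t : R, x < t < y -> t \notin s -> is_derive t 1 H (dH t) /\ dH t <= 0) ->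
  H y <= H x.
Proof.
elim: s x y => [|c s IH] x y xy cH dHP.
  move: xy; rewrite le_eqVlt => /predU1P[->//|xy].
  have [t|//|c] := @MVT R H dH x y xy.
    by rewrite in_itv/= => /dHP[].
  rewrite in_itv/= => /dHP[//|_ d0] /eqP; rewrite subr_eq => /eqP ->.
  by rewrite gerDr mulr_le0_ge0// subr_ge0 ltW.
have [/andP[xc cy]|xcy] := boolP (x < c < y).
  apply: (@le_trans _ _ (H c)).
    apply: IH (ltW cy) _ _.
      by apply: continuous_subspaceW cH; apply: subset_itvr; rewrite bnd_simp ltW.
    move=> t /andP[ct ty] ts; apply: dHP; first by rewrite ty (lt_trans xc).
    by rewrite in_cons negb_or ts gt_eqF.
  apply: IH (ltW xc) _ _.
    by apply: continuous_subspaceW cH; apply: subset_itvl; rewrite bnd_simp ltW.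
  move=> t /andP[xt tc] ts; apply: dHP; first by rewrite xt (lt_trans tc).
  by rewrite in_cons negb_or ts lt_eqF.
apply: IH => // t xty ts; apply: dHP => //.
by rewrite in_cons negb_or ts andbT; apply: contraNneq xcy => <-.
Qed.

(** [t0] is the supremum of the points of [[0, t1]] where [W <= 0]; continuity keeps [W <= 0]
    there. *)
Lemma last_nonpos_point W (t1 : R) : 0 <= t1 ->
  {within `[0, t1], continuous W} -> W 0 <= 0 ->
  exists t0 : R, [/\ 0 <= t0 <= t1, W t0 <= 0 & forall t : R, t0 < t <= t1 -> 0 < W t].
Proof.
move=> t10 cW W0; pose A := [set t : R | 0 <= t <= t1 /\ W t <= 0].
have A0 : A 0 by rewrite /A/= lexx.
have Aub : ubound A t1 by move=> t [/andP[]].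
have hA : has_sup A by split; [exists 0|exists t1].
exists (sup A).
have s0 : 0 <= sup A by apply: ub_le_sup => //; exists t1.
have s1 : sup A <= t1 by apply: ge_sup => //; exists 0.
have pos t : sup A < t <= t1 -> 0 < W t.
  move=> /andP[st tt1]; rewrite ltNge; apply/negP => Wt.
  have : t <= sup A.
    by apply: ub_le_sup; [exists t1|split => //; rewrite tt1 (le_trans s0 (ltW st))].
  by rewrite leNgt st.
split=> //; first by rewrite s0.
rewrite leNgt; apply/negP => Ws.
have sI : `[0, t1]%classic (sup A) by rewrite /= in_itv/= s0.
move/subspace_continuousP : cW => /(_ _ sI) /cvgr_gt /(_ _ Ws).
rewrite near_withinE => -[d /= d0 dW].
have [t At st] := sup_adherent d0 hA.
have [t01 Wt] := At.
have : 0 < W t.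
  apply: dW; last by rewrite /= in_itv/=.
  rewrite /= ger0_norm ?subr_ge0 ?ltrBlDr -?ltrBlDl//.
  by apply: ub_le_sup => //; exists t1.
by rewrite ltNge Wt.
Qed.

(** One-sided Gronwall: the inequality is only demanded where [W > 0]. Past the last point with
    [W <= 0], [W t * exp (- K t)] is nonincreasing, so [W] cannot become positive. *)
Lemma comparison_nonpos W dW s (K T : R) : 0 <= T ->
  {within `[0, T], continuous W} ->
  (forall t : R, 0 < t < T -> t \notin s -> is_derive t 1 W (dW t)) ->
  (forall t : R, 0 < t < T -> t \notin s -> 0 < W t -> dW t <= K * W t) ->
  W 0 <= 0 -> forall t : R, 0 <= t <= T -> W t <= 0.
Proof.
move=> T0 cW dWP dWle W0 t1 /andP[t10 t1T].
have cW1 : {within `[0, t1], continuous W}.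
  by apply: continuous_subspaceW cW; apply: subset_itvl; rewrite bnd_simp.
have [t0 [/andP[t00 t01] Wt0 pos]] := last_nonpos_point t10 cW1 W0.
rewrite leNgt; apply/negP => Wt1.
pose E (t : R) : R := expR (- K * t).
have dE (t : R) : is_derive t 1 E (E t * - K).
  apply: (@is_derive1_comp _ expR (fun t : R => - K * t)).
  by apply: is_derive_eq; rewrite /GRing.scale/= mulr1.
pose Z (t : R) : R := W t * E t.
have : Z t1 <= Z t0.
  apply: (@le0_derive_off_finite_le _ (fun t => W t *: (E t * - K) + E t *: dW t) s) => //.
    have cW2 : {within `[t0, t1], continuous W}.
      by apply: continuous_subspaceW cW1; apply: subset_itvr; rewrite bnd_simp.
    move=> x; apply: cvgM; first exact: cW2.
    apply: continuous_subspaceT => {}x.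
    by apply: differentiable_continuous; apply/derivable1_diffP; case: (dE x).
  move=> t /andP[tt0 tt1] ts.
  have tT : 0 < t < T by rewrite (le_lt_trans t00 tt0)/= (lt_le_trans tt1).
  have Wt : 0 < W t by apply: pos; rewrite tt0 ltW.
  split; first by apply: is_deriveM; exact: dWP.
  rewrite /GRing.scale/= (_ : _ + _ = E t * (dW t - K * W t)); last by ring.
  by rewrite mulr_ge0_le0 ?expR_ge0// subr_le0 dWle.
rewrite leNgt => /negP; apply; apply: (@le_lt_trans _ _ 0).
  by rewrite mulr_le0_ge0// expR_ge0.
by rewrite mulr_gt0// expR_gt0.
Qed.

End Comparison.

(** * Primitives and measurability on bounded intervals *)

Section Primitive.
Context {R : realType}.
Local Notation mu := (@lebesgue_measure R).

Lemma is_derive_primitive (h : R -> R) (T t : R) :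
  mu.-integrable `[0, T] (EFin \o h) -> 0 < t < T -> {for t, continuous h} ->
  is_derive t 1 (fun u => \int[mu]_(x in `[0, u]) h x) (h t).
Proof.
move=> ih /andP[t0 tT] ch; have [d dE] := continuous_FTC1_closed tT ih t0 ch.
by rewrite derive1E in dE; exact: DeriveDef d dE.
Qed.

Lemma normr_primitive_le (h : R -> R) (T t : R) :
  mu.-integrable `[0, T] (EFin \o h) -> t <= T ->
  `|\int[mu]_(x in `[0, t]) h x| <= \int[mu]_(x in `[0, T]) `|h x|.
Proof.
move=> ih tT.
have sub : `[0, t] `<=` `[0, T] by apply: subset_itvl; rewrite bnd_simp.
have iht : mu.-integrable `[0, t] (EFin \o h).
  by apply: integrableS ih.
apply: le_trans (le_normr_Rintegral _ iht) _ => //.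
have ia := integrable_norm ih.
rewrite /Rintegral fine_le//.
- by apply: integrable_fin_num => //; exact: integrable_norm iht.
- by apply: integrable_fin_num => //.
- apply: ge0_subset_integral => //; first by case/integrableP : ia.
Qed.

(* The lower integrals of the positive and negative parts are monotone in [t]. *)
Lemma measurable_primitive (h : R -> R) :
  measurable_fun setT (fun t : R => \int[mu]_(x in `[0, t]) h x).
Proof.
have mono (M : R -> \bar R) : {homo M : x y / x <= y >-> (x <= y)%E} ->
    measurable_fun setT M.
  move=> Mmono.
  apply: (measurability (@ErealGenOInfty.G R)) => [|/= _ [_] [r] -> <-].
    exact: ErealGenOInfty.measurableE.
  apply: measurableI => //; apply: is_interval_measurable => x y/=.
  rewrite !in_itv/= !andbT => Mx _ z /andP[xz _].
  by rewrite in_itv/= andbT (lt_le_trans Mx)// Mmono.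
rewrite /Rintegral; apply: measurableT_comp => //.
have patch_le (x y z : R) : x <= y ->
    ((((fun u : R => (h u)%:E) \_ `[0%R, x])^\+ z <=
      ((fun u : R => (h u)%:E) \_ `[0%R, y])^\+ z)%E *
     (((fun u : R => (h u)%:E) \_ `[0%R, x])^\- z <=
      ((fun u : R => (h u)%:E) \_ `[0%R, y])^\- z)%E)%type.
  move=> xy; rewrite funeposE funenegE !funeposE !funenegE !patchE.
  case: ifPn => [|_]; last by rewrite oppe0 maxxx !le_max !lexx !orbT.
  rewrite inE/= in_itv/= => /andP[z0 zx].
  by rewrite ifT// inE/= in_itv/= z0 (le_trans zx).
rewrite /integral/=; apply: emeasurable_funB; apply: mono => x y xy;
  apply: ereal_sup_le; apply: image_subset => g /= gx z;
  by apply: le_trans (gx z) _; case: (patch_le x y z xy).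
Qed.

(** At least one of the two parts has infinite integral, so the difference is infinite ([+oo - +oo]
    being [-oo]), and [fine] sends it to 0. *)
Lemma nonintegrable_primitive0 (h : R -> R) (D : set R) : measurable D ->
  measurable_fun D h -> ~ mu.-integrable D (EFin \o h) ->
  \int[mu]_(x in D) h x = 0.
Proof.
move=> mD mh nih; have mEh : measurable_fun D (EFin \o h) by exact/measurable_EFinP.
rewrite /Rintegral integralE.
have ip : (0 <= \int[mu]_(x in D) ((fun x => (h x)%:E)^\+ x))%E by exact: integral_ge0.
have im : (0 <= \int[mu]_(x in D) ((fun x => (h x)%:E)^\- x))%E by exact: integral_ge0.
have : (\int[mu]_(x in D) `|(h x)%:E| = \int[mu]_(x in D) ((fun x => (h x)%:E)^\+ x)
    + \int[mu]_(x in D) ((fun x => (h x)%:E)^\- x))%E.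
  rewrite -ge0_integralD//; last 2 first.
    exact: measurable_funepos.
    exact: measurable_funeneg.
  by apply: eq_integral => x _; rewrite -[LHS]/((abse \o (EFin \o h)) x) fune_abse.
case: (\int[mu]_(x in D) _)%E ip => [p| |]//; case: (\int[mu]_(x in D) _)%E im => [m| |]// _ _ E.
exfalso; apply: nih; apply/integrableP; split => //.
by rewrite /= E -EFinD ltry.
Qed.

Lemma bounded_itv_integrable (h : R -> R) (T C : R) :
  measurable_fun `[0, T] h -> (forall t, 0 <= t <= T -> `|h t| <= C) ->
  mu.-integrable `[0, T] (EFin \o h).
Proof.
move=> mh hC; apply: measurable_bounded_integrable => //.
  by rewrite [ltLHS]lebesgue_measure_itv/=; case: ifP => // _; rewrite -EFinD ltry.
exists C; split; first exact: num_real.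
by move=> M CM t /=; rewrite in_itv/= => /hC /le_trans; apply; exact: ltW.
Qed.

Lemma measurable_fun_off_finite (s : seq R) (A : set R) (h : R -> R) :
  measurable A -> measurable_fun (A `\` [set` s]) h -> measurable_fun A h.
Proof.
elim: s A => [|c s IH] A mA.
  by rewrite (_ : _ `\` _ = A)//; apply/seteqP; split => [x []|x Ax]//; split.
move=> mh; have mAc : measurable (A `\ c) by exact: measurableD.
have : measurable_fun ((A `\ c) `|` [set c]) h.
  apply/measurable_funU => //; split; last exact: measurable_fun_set1.
  apply: IH => //; rewrite (_ : _ `\` _ = A `\` [set` c :: s])//.
  apply/seteqP; split => x /=.
    by move=> [[Ax xc] xs]; split => //; rewrite in_cons => /orP[/eqP|].
  move=> [Ax]; rewrite in_cons => /negP; rewrite negb_or => /andP[/eqP xc /negP xs].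
  by split => //; split.
apply: measurable_funS => //; first exact: measurableU.
by move=> x Ax; have [->|xc] := eqVneq x c; [right|left; split => //; exact/eqP].
Qed.

Lemma continuous_off_finite_measurable (s : seq R) (T : R) (h : R -> R) :
  (forall t, 0 < t < T -> t \notin s -> {for t, continuous h}) ->
  measurable_fun `[0, T] h.
Proof.
(* Continuity is only known inside the open interval, so both endpoints join the exceptional
   list. *)
move=> ch; apply: (@measurable_fun_off_finite [:: 0, T & s]) => //.
apply: subspace_continuous_measurable_fun.
  apply: measurableD => //; apply: countable_measurable => //.
  exact/finite_set_countable/finite_seq.
apply: continuous_in_subspaceT => t; rewrite inE /= in_itv/= !inE.
move=> [/andP[t0 tT]] /negP; rewrite !negb_or => /and3P[tn0 tnT ts].
by apply: ch => //; rewrite !lt_neqAle t0 tT eq_sym tn0 tnT.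
Qed.

End Primitive.

(** * Limits, measurability and derivatives of vector expressions, by coordinates *)

Section VectorCalculus.
Context {R : realType} {n : nat}.
Implicit Types (a : R -> 'cV[R]_n) (A : 'M[R]_n).

Lemma mulmx_coordE A (x : 'cV[R]_n) i : (A *m x) i 0 = \sum_j A i j * x j 0.
Proof. by rewrite mxE. Qed.

(** The filter is arbitrary so that the limit lemmas apply both to ordinary neighbourhoods and to
    those of the subspace topology of an interval. *)
Lemma cvg_mulmx_coord (T : Type) (F : set_system T) {FF : Filter F}
    (a : T -> 'cV[R]_n) (b : 'cV[R]_n) A i :
  (forall i, a t i 0 @[t --> F] --> b i 0) ->
  (A *m a t) i 0 @[t --> F] --> (A *m b) i 0.
Proof.
move=> ab; rewrite mulmx_coordE; under eq_fun do rewrite mulmx_coordE.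
by apply: cvg_sumr => j; apply: cvgMl_tmp.
Qed.

Lemma cvg_dotv (T : Type) (F : set_system T) {FF : Filter F}
    (a c : T -> 'cV[R]_n) (b d : 'cV[R]_n) :
  (forall i, a t i 0 @[t --> F] --> b i 0) ->
  (forall i, c t i 0 @[t --> F] --> d i 0) ->
  dotv (a t) (c t) @[t --> F] --> dotv b d.
Proof.
move=> ab cd; rewrite dotvE; under eq_fun do rewrite dotvE.
by apply: cvg_sumr => j; apply: cvgM.
Qed.

Lemma cvg_enorm (T : Type) (F : set_system T) {FF : Filter F}
    (a : T -> 'cV[R]_n) (b : 'cV[R]_n) :
  (forall i, a t i 0 @[t --> F] --> b i 0) -> enorm (a t) @[t --> F] --> enorm b.
Proof.
move=> ab; rewrite /enorm; apply: (@continuous_cvg _ _ _ _ _ _ Num.sqrt); first exact: sqrt_continuous.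
by apply: cvg_sumr => j; rewrite expr2; under eq_fun do rewrite expr2; apply: cvgM.
Qed.

Lemma cvg_quadratic_field (T : Type) (F : set_system T) {FF : Filter F}
    (a : T -> 'cV[R]_n) (b : 'cV[R]_n) L (Rm : 'I_n -> 'M[R]_n) (i : 'I_n) :
  (forall i, a t i 0 @[t --> F] --> b i 0) ->
  (L *m a t + Ups Rm (a t)) i 0 @[t --> F] --> (L *m b + Ups Rm b) i 0.
Proof.
move=> ab; have E x : (L *m x + Ups Rm x) i 0 = (L *m x) i 0 + dotv x (Rm i *m x).
  by rewrite mxE; congr (_ + _); rewrite mxE quad_dotv.
rewrite E; under eq_fun do rewrite E; apply: cvgD; first exact: cvg_mulmx_coord.
by apply: cvg_dotv => // j; exact: cvg_mulmx_coord.
Qed.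

Lemma measurable_mulmx_coord (D : set R) a A i :
  (forall i, measurable_fun D (fun t => a t i 0)) ->
  measurable_fun D (fun t => (A *m a t) i 0).
Proof.
move=> ma; under eq_fun do rewrite mulmx_coordE.
by apply: measurable_sum => j; apply: measurable_funM.
Qed.

Lemma measurable_dotv (D : set R) (a c : R -> 'cV[R]_n) :
  (forall i, measurable_fun D (fun t => a t i 0)) ->
  (forall i, measurable_fun D (fun t => c t i 0)) ->
  measurable_fun D (fun t => dotv (a t) (c t)).
Proof.
move=> ma mc; under eq_fun do rewrite dotvE.
by apply: measurable_sum => j; apply: measurable_funM.
Qed.

Lemma measurable_enorm (D : set R) a :
  (forall i, measurable_fun D (fun t => a t i 0)) ->
  measurable_fun D (fun t => enorm (a t)).
Proof.
move=> ma; apply: (measurableT_comp (f := @Num.sqrt R)).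
  by apply: continuous_measurable_fun; exact: sqrt_continuous.
by apply: measurable_sum => j; apply: measurable_funX.
Qed.

Lemma measurable_quadratic_field (D : set R) a L (Rm : 'I_n -> 'M[R]_n) (i : 'I_n) :
  (forall i, measurable_fun D (fun t => a t i 0)) ->
  measurable_fun D (fun t => (L *m a t + Ups Rm (a t)) i 0).
Proof.
move=> ma; have E x : (L *m x + Ups Rm x) i 0 = (L *m x) i 0 + dotv x (Rm i *m x).
  by rewrite mxE; congr (_ + _); rewrite mxE quad_dotv.
under eq_fun do rewrite E; apply: measurable_funD.
  exact: measurable_mulmx_coord.
by apply: measurable_dotv => // j; exact: measurable_mulmx_coord.
Qed.

Lemma normr_mulmx_coord_le A (x : 'cV[R]_n) (C : R) i :
  (forall j, `|x j 0| <= C) -> `|(A *m x) i 0| <= \sum_j `|A i j| * C.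
Proof.
move=> xC; rewrite mulmx_coordE (le_trans (ler_norm_sum _ _ _))//.
by apply: ler_sum => j _; rewrite normrM ler_wpM2l.
Qed.

(** This turns a bound on the trajectory into one on the unforced field, from which integrability
    will follow. *)
Lemma normr_quadratic_field_le L (Rm : 'I_n -> 'M[R]_n) (C : R) :
  0 <= C -> exists K : R, forall x : 'cV[R]_n, (forall j, `|x j 0| <= C) ->
  forall i, `|(L *m x + Ups Rm x) i 0| <= K.
Proof.
move=> C0.
pose B (A : 'M[R]_n) i := \sum_j `|A i j| * C.
have B0 A i : 0 <= B A i by apply: sumr_ge0 => j _; rewrite mulr_ge0.
pose K i := B L i + \sum_j C * B (Rm i) j.
have K0 i : 0 <= K i by rewrite addr_ge0// sumr_ge0// => j _; rewrite mulr_ge0.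
exists (\sum_i K i) => x xC i; apply: (@le_trans _ _ (K i)); last first.
  by rewrite [leRHS](bigD1 i)//= lerDl sumr_ge0.
rewrite mxE (le_trans (ler_normD _ _))// lerD//; first exact: normr_mulmx_coord_le.
rewrite mxE quad_dotv dotvE (le_trans (ler_norm_sum _ _ _))//.
by apply: ler_sum => j _; rewrite normrM ler_pM//; exact: normr_mulmx_coord_le.
Qed.

Lemma is_derive_sumr (f : 'I_n -> R -> R) (df : 'I_n -> R) (t : R) :
  (forall i, is_derive t 1 (f i) (df i)) ->
  is_derive t 1 (fun u => \sum_i f i u) (\sum_i df i).
Proof.
move=> fd; rewrite (_ : (fun u => _) = \sum_i f i); first exact: is_derive_sum.
by apply/funext => u; rewrite fct_sumE.
Qed.

(** The product rule gives [<a, A a'> + <A a, a'>], and symmetry of [A] makes the two terms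
    equal. *)
Lemma is_derive_quad a (da : 'cV[R]_n) A (t : R) : symmetric_mx A ->
  (forall i, is_derive t 1 (fun u => a u i 0) (da i 0)) ->
  is_derive t 1 (fun u => dotv (a u) (A *m a u)) (2 * dotv (a t) (A *m da)).
Proof.
move=> sA ad; under eq_fun do rewrite dotvE.
have -> : 2 * dotv (a t) (A *m da) =
    \sum_i (a t i 0 *: (A *m da) i 0 + (A *m a t) i 0 *: da i 0).
  rewrite big_split/= -!dotvE.
  by rewrite dotv_mulmxl sA mulrDl mul1r.
apply: is_derive_sumr => i; apply: is_deriveM.
rewrite mulmx_coordE; under eq_fun do rewrite mulmx_coordE.
apply: is_derive_sumr => j.
Qed.

End VectorCalculus.

(** * Regularity and continuation of solutions of the integral equation *)

Section Trajectory.
Context {R : realType} {n : nat}.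
Local Notation mu := (@lebesgue_measure R).
Variables (L : 'M[R]_n) (Rm : 'I_n -> 'M[R]_n) (a0 : 'cV[R]_n) (tau : R).
Variables (f a : R -> 'cV[R]_n) (sf : seq R).
Hypothesis f_cont : forall t : R, 0 < t < tau -> t \notin sf ->
  forall i, {for t, continuous (fun u => f u i 0)}.
Hypothesis a_sol : is_solution L Rm f a0 tau a.

Let phi (t : R) : 'cV[R]_n := L *m a t + Ups Rm (a t) + f t.

Let phiE t i : phi t i 0 = (L *m a t + Ups Rm (a t)) i 0 + f t i 0.
Proof. by rewrite /phi mxE. Qed.

(** On such an interval the integrals in the equation are genuine and not default values, so the
    solution is continuous there, and differentiable inside it off [sf]. *)
Definition integrable_until (T : R) :=
  0 <= T <= tau /\ forall i, mu.-integrable `[0, T] (EFin \o (fun t => phi t i 0)).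

Lemma solution_coord (t : R) i : 0 <= t <= tau ->
  a t i 0 = a0 i 0 + \int[mu]_(x in `[0, t]) phi x i 0.
Proof. by move=> tt; rewrite (a_sol tt) !mxE. Qed.

Lemma solution0 : 0 <= tau -> a 0 = a0.
Proof.
move=> tau0; apply/colP => i; rewrite solution_coord ?lexx// set_itv1.
by rewrite Rintegral_set1 addr0.
Qed.

(** Available before any integrability, since every primitive is measurable. The field is then
    measurable too, so that only its size can prevent integrability. *)
Lemma solution_measurable i : measurable_fun `[0, tau] (fun t => a t i 0).
Proof.
pose b (t : R) : R := a0 i 0 + \int[mu]_(x in `[0, t]) phi x i 0.
have ab : {in `[0, tau]%classic, b =1 fun t => a t i 0}.
  by move=> t; rewrite inE/= in_itv/= => tt; rewrite solution_coord.
apply: eq_measurable_fun ab _; apply: measurable_funD => //; apply: measurable_funTS; exact: measurable_primitive.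
Qed.

Lemma input_measurable i : measurable_fun `[0, tau] (fun t => f t i 0).
Proof.
by apply: (@continuous_off_finite_measurable _ sf) => t tt ts; exact: f_cont.
Qed.

Lemma field_measurable i : measurable_fun `[0, tau] (fun t => phi t i 0).
Proof.
rewrite (funext (fun t => phiE t i)); apply: measurable_funD; last exact: input_measurable.
by apply: measurable_quadratic_field => j; exact: solution_measurable.
Qed.

Lemma bounded_integrable_until (T C r : R) : 0 <= T <= tau -> 0 <= C ->
  (forall t, 0 <= t <= tau -> enorm (f t) <= r) ->
  (forall t i, 0 <= t <= T -> `|a t i 0| <= C) -> integrable_until T.
Proof.
move=> TT C0 fr aC; split=> // i.
have [K KP] := normr_quadratic_field_le L Rm C0.
apply: (@bounded_itv_integrable _ _ _ (K + r)).
  apply: measurable_funS (field_measurable i) => //.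
  by apply: subset_itvl; rewrite bnd_simp; case/andP : TT.
move=> t tT; rewrite phiE (le_trans (ler_normD _ _))// lerD//.
  by apply: KP => j; exact: aC.
apply: le_trans (normr_coord_le_enorm _ _) _; apply: fr.
by case/andP : tT => -> /= /le_trans; apply; case/andP : TT.
Qed.

Section Integrable.
Variable T : R.
Hypothesis aT : integrable_until T.

Lemma solution_continuous i : {within `[0, T], continuous (fun t => a t i 0)}.
Proof.
have [/andP[T0 Ttau] ih] := aT.
have := parameterized_integral_continuous T0 (ih i) => cI.
pose b (t : R) : R := a0 i 0 + \int[mu]_(x in `[0, t]) phi x i 0.
have ab : {in `[0, T]%classic, b =1 fun t => a t i 0}.
  move=> t; rewrite inE/= in_itv/= => /andP[t0 tT].
  by rewrite [RHS]solution_coord// t0 (le_trans tT).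
apply: (subspace_eq_continuous ab).
by move=> x; apply: cvgD; [exact: cvg_cst|exact: cI].
Qed.

Lemma solution_continuous_at (t : R) i : 0 < t < T -> {for t, continuous (fun t => a t i 0)}.
Proof.
move=> tT; have T0 : 0 < T by case/andP : tT => /lt_trans; exact.
have [+ _ _] := (continuous_within_itvP _ T0).1 (@solution_continuous i).
by apply; rewrite in_itv.
Qed.

Lemma solution_is_derive (t : R) i : 0 < t < T -> t \notin sf ->
  is_derive t 1 (fun t => a t i 0) (phi t i 0).
Proof.
move=> tT ts; have [/andP[T0 Ttau] ih] := aT.
have [t0 tT'] := andP tT.
have cphi : {for t, continuous (fun u => phi u i 0)}.
  rewrite /prop_for /continuous_at phiE; under eq_fun do rewrite phiE.
  apply: cvgD; last by apply: f_cont => //; rewrite t0 (lt_le_trans tT').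
  by apply: (@cvg_quadratic_field _ _ _ (nbhs t)) => j; exact: solution_continuous_at.
apply: (@near_eq_is_derive _ _ _ (cst (a0 i 0) + (fun u : R => \int[mu]_(x in `[0, u]) phi x i 0))).
  near=> u; rewrite /= -[LHS]/(_ + _) -solution_coord//.
  have /andP[u0 uT] : 0 < u < T.
    by near: u; exact: near_in_itvoo.
  by rewrite (ltW u0) (le_trans (ltW uT)).
apply: is_derive_eq; last exact: add0r.
by apply: is_deriveD; exact: (is_derive_primitive (ih i)).
Unshelve. all: by end_near. Qed.

Lemma solution_quad_continuous (A : 'M[R]_n) :
  {within `[0, T], continuous (fun t => dotv (a t) (A *m a t))}.
Proof.
move=> x; apply: (@cvg_dotv _ _ _ (nbhs x)) => i; first exact: solution_continuous.
by apply: (@cvg_mulmx_coord _ _ _ (nbhs x)) => j; exact: solution_continuous.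
Qed.

End Integrable.

(* A component whose integrand fails to be integrable just after [T] has, by the
   convention [Rintegral = 0], the constant value [a0 i 0] there: blow-up is excluded. *)
Lemma solution_integrable (r C : R) : 0 <= tau -> 0 <= C ->
  (forall t, 0 <= t <= tau -> enorm (f t) <= r) ->
  (forall T, integrable_until T -> forall t, 0 <= t <= T -> enorm (a t) <= C) ->
  integrable_until tau.
Proof.
move=> tau0 C0 fr apriori.
have bnd T : 0 <= T <= tau ->
    (forall i, exists B, forall t, 0 <= t <= T -> `|a t i 0| <= B) -> integrable_until T.
  move=> TT /choice[B BP]; apply: (@bounded_integrable_until _ (\sum_i `|B i|) r) => //.
    by rewrite sumr_ge0.
  move=> t i tT; apply: le_trans (BP i t tT) _; rewrite (bigD1 i)//=.
  by rewrite (le_trans (ler_norm _))// lerDl sumr_ge0.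
have S0 : integrable_until 0.
  apply: bnd; first by rewrite lexx.
  move=> i; exists `|a 0 i 0| => t; rewrite -eq_le => /eqP <-; exact: lexx.
pose S := [set T | integrable_until T].
have Sub : ubound S tau by move=> T [/andP[]].
have hS : has_sup S by split; [exists 0|exists tau].
pose T := sup S.
have T0 : 0 <= T by apply: ub_le_sup => //; exists tau.
have Ttau : T <= tau by apply: ge_sup => //; exists 0.
have aC t : 0 <= t < T -> enorm (a t) <= C.
  move=> /andP[t0 tT]; have d0 : 0 < T - t by rewrite subr_gt0.
  have [u Su] := sup_adherent d0 hS; rewrite subKr => tu.
  by apply: (apriori u Su); rewrite t0 ltW.
(* The a priori bound is known only before [T], so the value at [T] itself enters the bound
   explicitly. *)
have aT i t : 0 <= t <= T -> `|a t i 0| <= C + `|a T i 0|.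
  move=> /andP[t0]; rewrite le_eqVlt => /predU1P[->|tT]; first by rewrite lerDr.
  rewrite (le_trans (normr_coord_le_enorm _ _))// (le_trans (aC t _)) ?t0//.
  by rewrite lerDl.
have ST : integrable_until T.
  by apply: bnd => [|i]; [rewrite T0|exists (C + `|a T i 0|) => t; exact: aT].
move: Ttau; rewrite le_eqVlt => /predU1P[<-//|Ttau].
have : \forall u \near T^'+, forall i,
    exists B, forall t, 0 <= t <= u -> `|a t i 0| <= B.
  (* There are finitely many components, so each is treated alone. Either its field is integrable up
     to some [v > T], and the primitive is bounded by the integral of [|phi|] over [[0, v]]; or it
     is integrable up to no such [v], and the component is constant on []T, tau]]. *)
  apply: filter_forall => i.
  have [[v /andP[Tv vtau] iv]|nv] := pselect (exists2 v, T < v <= tau &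
      mu.-integrable `[0, v] (EFin \o (fun t => phi t i 0))).
    near=> u; exists (`|a0 i 0| + \int[mu]_(x in `[0, v]) `|phi x i 0|).
    move=> t /andP[t0 tu].
    have uv : u <= v by near: u; exact: nbhs_right_le.
    have tv := le_trans tu uv.
    rewrite solution_coord ?t0 ?(le_trans tv)// (le_trans (ler_normD _ _))// lerD2l.
    exact: normr_primitive_le.
  near=> u; exists (C + `|a T i 0| + `|a0 i 0|) => t /andP[t0 tu].
  have [tT|Tt] := leP t T; first by rewrite ler_wpDr// aT// t0.
  have utau : u <= tau by near: u; exact: nbhs_right_le.
  have ttau := le_trans tu utau.
  rewrite solution_coord ?t0// nonintegrable_primitive0 ?addr0//.
  - by rewrite lerDr addr_ge0.
  - apply: measurable_funS (field_measurable i) => //.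
    by apply: subset_itvl; rewrite bnd_simp.
  - by move=> it; apply: nv; exists t => //; rewrite Tt.
move=> Bn; have [u [Tu utau] Bu] : exists2 u, T < u /\ u <= tau &
    forall i, exists B, forall t, 0 <= t <= u -> `|a t i 0| <= B.
  near T^'+ => u; exists u; last by near: u.
  by split; near: u; [exact: nbhs_right_gt|exact: nbhs_right_le].
have : u <= T.
  apply: ub_le_sup; first by exists tau.
  by apply: bnd => //; rewrite utau (le_trans T0)// ltW.
by rewrite leNgt Tu.
Unshelve. all: by end_near. Qed.

End Trajectory.

(** * Real powers, Hoelder's inequality and norms of truncations *)

Section LpEstimates.
Context {R : realType}.
Local Notation mu := (@lebesgue_measure R).

Lemma powR_le (q x y : R) : 0 <= q -> 0 <= x -> x <= y -> x `^ q <= y `^ q.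
Proof.
move=> q0 x0 xy; apply: ge0_ler_powR => //; rewrite nnegrE//.
exact: le_trans xy.
Qed.

(** If [X > A + B], then [X^p = X * X^(p-1)] exceeds [A X^(p-1) + B X^(p-1)], hence also
    [A X^(p-1) + B^p]. *)
Lemma le_add_of_powR_le (A B X p : R) : 0 <= A -> 0 <= B -> 0 <= X -> 1 <= p ->
  X `^ p <= B `^ p + A * X `^ (p - 1) -> X <= A + B.
Proof.
move=> A0 B0 X0 p1 H; rewrite leNgt; apply/negP => ABX.
have p0 : 0 < p := lt_le_trans ltr01 p1.
have Xp : 0 < X by apply: le_lt_trans ABX; rewrite addr_ge0.
have BX : B <= X by apply: ltW; apply: le_lt_trans ABX; rewrite lerDr.
have pw : B `^ (p - 1) <= X `^ (p - 1).
  by apply: powR_le => //; rewrite subr_ge0.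
have Xpp : 0 < X `^ (p - 1) by exact: powR_gt0.
have := ltr_pM2r Xpp (A + B) X; rewrite ABX mulr_powRB1// => /idP.
have := ler_wpM2l B0 pw; rewrite mulr_powRB1// => h1 h2.
by move: h2; rewrite mulrDl; lra.
Qed.

Lemma cvg_powR (T : Type) (F : set_system T) {FF : Filter F} (g : T -> R) (q y : R) :
  0 < y -> g u @[u --> F] --> y -> g u `^ q @[u --> F] --> y `^ q.
Proof.
move=> y0; apply: (@continuous_cvg _ _ _ F _ _ (fun y => y `^ q)).
apply: differentiable_continuous; apply/derivable1_diffP.
by case: (is_derive1_powR q y0).
Qed.

Lemma bounded_powR_integrable (g : R -> R) (T C q : R) : 0 <= q ->
  measurable_fun `[0, T] g -> (forall t, 0 <= t <= T -> 0 <= g t <= C) ->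
  mu.-integrable `[0, T] (EFin \o (fun t => g t `^ q)).
Proof.
move=> q0 mg gC; apply: (@bounded_itv_integrable _ _ _ (C `^ q)).
  exact: (measurableT_comp (measurable_powR q) mg).
move=> t /gC /andP[g0 gle]; rewrite ger0_norm ?powR_ge0//.
exact: powR_le.
Qed.

Lemma integrable_itvZl (c T : R) (g : R -> R) :
  mu.-integrable `[0, T] (EFin \o g) ->
  mu.-integrable `[0, T] (EFin \o (fun t => c * g t)).
Proof.
move=> ig; rewrite (_ : EFin \o _ = (fun t => c%:E * (EFin \o g) t)%E)//.
exact: integrableZl.
Qed.

Lemma Lnorm_patch (T p : R) (g : R -> R) : 0 < p ->
  (forall t, 0 <= t <= T -> 0 <= g t) ->
  mu.-integrable `[0, T] (EFin \o (fun t => g t `^ p)) ->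
  'N[mu]_p%:E[EFin \o (g \_ `[0%R, T])]%E =
  ((\int[mu]_(t in `[0, T]) (g t `^ p)) `^ p^-1)%:E.
Proof.
move=> p0 g0 ig; rewrite unlock /= -poweR_EFin; congr (_ `^ _)%E.
rewrite /Rintegral fineK; last exact: integrable_fin_num.
rewrite [RHS]integral_mkcond; apply: eq_integral => t _ /=.
rewrite !patchE; case: ifPn => [|_].
  by rewrite inE/= in_itv/= => /g0 gt0; rewrite ger0_norm.
by rewrite normr0 powR0// gt_eqF.
Qed.

(** Hoelder with [p] and [q = p / (p - 1)]: as [(u^(p-1))^q = u^p], only the L_p norm of [u] appears
    on the right. *)
Lemma hoelder_itv (T p : R) (g u : R -> R) : 1 <= p ->
  measurable_fun `[0, T] g -> measurable_fun `[0, T] u ->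
  (forall t, 0 <= t <= T -> 0 <= g t) -> (forall t, 0 <= t <= T -> 0 <= u t) ->
  mu.-integrable `[0, T] (EFin \o (fun t => g t `^ p)) ->
  mu.-integrable `[0, T] (EFin \o (fun t => u t `^ p)) ->
  mu.-integrable `[0, T] (EFin \o (fun t => g t * u t `^ (p - 1))) ->
  \int[mu]_(t in `[0, T]) (g t * u t `^ (p - 1)) <=
  (\int[mu]_(t in `[0, T]) (g t `^ p)) `^ p^-1 *
  ((\int[mu]_(t in `[0, T]) (u t `^ p)) `^ p^-1) `^ (p - 1).
Proof.
move=> + mg mu_ g0 u0 ig iu igu; rewrite le_eqVlt => /predU1P[p1|p1].
  (* For [p = 1] the conjugate exponent would be infinite; here [x^0 = 1] for every [x], 0 included,
     makes both sides equal. *)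
  rewrite -p1 subrr powRr0 invr1 powRr1; last first.
    by apply: Rintegral_ge0 => t _; exact: powR_ge0.
  rewrite mulr1 le_eqVlt; apply/orP; left; apply/eqP; apply: eq_Rintegral => t.
  by rewrite inE/= in_itv/= => /g0 gt0; rewrite powRr0 mulr1 powRr1.
have p0 : 0 < p := lt_trans ltr01 p1.
pose q := p / (p - 1).
have pm1 : 0 < p - 1 by rewrite subr_gt0.
have q0 : 0 < q by rewrite divr_gt0.
have pq : p^-1 + q^-1 = 1 by rewrite /q; field; rewrite !gt_eqF.
have uq t : (u t `^ (p - 1)) `^ q = u t `^ p.
  by rewrite -powRrM /q; congr (_ `^ _); field; rewrite gt_eqF.
pose w t := u t `^ (p - 1).
have mw : measurable_fun `[0, T] w.
  exact: (measurableT_comp (measurable_powR (p - 1)) mu_).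
have := hoelder mu ((measurable_restrictT _ (measurable_itv _)).1 mg)
  ((measurable_restrictT _ (measurable_itv _)).1 mw) p0 q0 pq.
rewrite Lnorm_patch// Lnorm_patch//; last first.
- by rewrite /w (_ : (fun t => _) = (fun t => u t `^ p))//; apply/funext => t; exact: uq.
- by move=> t _; exact: powR_ge0.
have -> : \int[mu]_(t in `[0, T]) (w t `^ q) = \int[mu]_(t in `[0, T]) (u t `^ p).
  by apply: eq_Rintegral => t _; exact: uq.
rewrite Lnorm1 /w.
have -> : q^-1 = p^-1 * (p - 1) by rewrite /q; field; rewrite !gt_eqF.
rewrite powRrM -EFinM -lee_fin; apply: le_trans.
rewrite /Rintegral fineK; last exact: integrable_fin_num.
rewrite [leLHS]integral_mkcond le_eqVlt; apply/orP; left; apply/eqP.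
apply: eq_integral => t _ /=; rewrite !patchE; case: ifPn => [|_].
  rewrite inE/= in_itv/= => tT; rewrite ger0_norm// mulr_ge0 ?powR_ge0//.
  exact: g0.
by rewrite mul0r normr0.
Qed.

Lemma Lp_norm_trunc (n : nat) (p tau : R) (g : R -> 'cV[R]_n) : 0 < p ->
  mu.-integrable `[0, tau] (EFin \o (fun t => enorm (g t) `^ p)) ->
  Lp_norm p%:E (trunc tau g) =
  ((\int[mu]_(t in `[0, tau]) (enorm (g t) `^ p)) `^ p^-1)%:E.
Proof.
move=> p0 ig; rewrite /Lp_norm -poweR_EFin; congr (_ `^ _)%E.
rewrite /Rintegral fineK; last exact: integrable_fin_num.
have -> : `[0, tau]%classic = `[0, +oo[%classic `&` `[0, tau]%classic :> set R.
  apply/seteqP; split => t /=; last by case.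
  by rewrite !in_itv/= andbT => /andP[-> ->].
rewrite integral_mkcondr; apply: eq_integral => t; rewrite inE/= in_itv/= andbT => t0.
rewrite patchE mem_setE /= in_itv/= t0 /trunc; case: ifP => // _.
rewrite (_ : enorm 0 = 0) ?powR0 ?gt_eqF//.
by rewrite /enorm big1 ?sqrtr0// => i _; rewrite mxE expr0n.
Qed.

End LpEstimates.

(** * Invariance and norm bounds from a quadratic Lyapunov inequality with abstract constants *)

Section Stability.
Context {R : realType} {n : nat}.
Variables (L : 'M[R]_n) (Rm : 'I_n -> 'M[R]_n) (P : 'M[R]_n) (s : 'I_n -> R).
Variables (delta eps lmin lmax nu : R).
Hypothesis P_sym : symmetric_mx P.
Hypothesis s_ge0 : forall m, 0 <= s m.
Hypothesis delta_gt0 : 0 < delta.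
Hypothesis eps_gt0 : 0 < eps.
Hypothesis lmin_gt0 : 0 < lmin.
Hypothesis lmin_le_lmax : lmin <= lmax.
Hypothesis lminP : forall x : 'cV[R]_n, lmin * dotv x x <= dotv x (P *m x).
Hypothesis lmaxP : forall x : 'cV[R]_n, dotv x (P *m x) <= lmax * dotv x x.
Hypothesis nu_ge0 : 0 <= nu.
Hypothesis lyapunov : forall x u : 'cV[R]_n,
  2 * dotv x (P *m (L *m x + Ups Rm x + u)) <=
  - eps * dotv x x + nu * enorm x * enorm u
  + (dotv x x - delta ^+ 2) * Rm_energy Rm s x.

Variables (a0 : 'cV[R]_n) (tau : R) (f a : R -> 'cV[R]_n) (sf : seq R).
Hypothesis tau_ge0 : 0 <= tau.
Hypothesis f_cont : forall t : R, 0 < t < tau -> t \notin sf ->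
  forall i, {for t, continuous (fun u => f u i 0)}.
Hypothesis a_sol : is_solution L Rm f a0 tau a.
Hypothesis a0_le : enorm a0 <= delta * Num.sqrt (lmin / lmax).
Hypothesis f_le : forall t : R, 0 <= t <= tau ->
  enorm (f t) <= lmin * eps * delta / (lmax * nu).

Let lmax_gt0 : 0 < lmax. Proof. exact: lt_le_trans lmin_le_lmax. Qed.

Let delta_ge0 : 0 <= delta. Proof. exact: ltW. Qed.
Let eps_ge0 : 0 <= eps. Proof. exact: ltW. Qed.
Let lmin_ge0 : 0 <= lmin. Proof. exact: ltW. Qed.
Let lmax_ge0 : 0 <= lmax. Proof. exact: ltW. Qed.

Let V (t : R) : R := dotv (a t) (P *m a t).
Let dV (t : R) : R := 2 * dotv (a t) (P *m (L *m a t + Ups Rm (a t) + f t)).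

Lemma V_is_derive (T t : R) : integrable_until L Rm tau f a T ->
  0 < t < T -> t \notin sf -> is_derive t 1 V (dV t).
Proof.
by move=> aT tT ts; apply: is_derive_quad => // i; exact: (solution_is_derive f_cont a_sol aT).
Qed.

Lemma V0E : V 0 = dotv a0 (P *m a0).
Proof. by rewrite /V (solution0 a_sol). Qed.

(** [comparison_nonpos] for [V - c]; used with [K = M / lmin] for the ball of radius [delta] and
    with [K = 0] for the supremum bound. *)
Lemma sublevel_invariant (c K T : R) : integrable_until L Rm tau f a T ->
  dotv a0 (P *m a0) <= c ->
  (forall t, 0 < t < T -> c < V t -> dV t <= K * (V t - c)) ->
  forall t, 0 <= t <= T -> V t <= c.
Proof.
move=> aT V0c dVc t tT; rewrite -subr_le0.
have T0 : 0 <= T by case: aT => /andP[].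
apply: (@comparison_nonpos _ (fun t => V t - c) dV sf K T) tT => //.
- move=> x; apply: cvgB; last exact: cvg_cst.
  exact: (solution_quad_continuous a_sol aT).
- move=> u uT us; rewrite -[dV u]subr0.
  by apply: is_deriveB; exact: V_is_derive aT uT us.
- by move=> u uT us; rewrite subr_gt0; exact: dVc.
- by rewrite V0E subr_le0.
Qed.

(* Above the level [lmin * delta ^ 2] the trajectory may leave the ball of radius
   [delta], but only by an amount controlled by [V - lmin * delta ^ 2]; hence the
   linear differential inequality instead of mere monotonicity. *)
Lemma solution_le_delta_until (T : R) : integrable_until L Rm tau f a T ->
  forall t, 0 <= t <= T -> enorm (a t) <= delta.
Proof.
move=> aT; have [/andP[T0 Ttau] _] := aT.
(* The energy is continuous along the trajectory, so it has a maximum [M] on the interval. The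
   growth rate [M / lmin] may depend on [T], as the conclusion does not involve it. *)
have [c _ cmax] : exists2 c, c \in `[0, T] &
    forall t, t \in `[0, T] -> Rm_energy Rm s (a t) <= Rm_energy Rm s (a c).
  apply: EVT_max => // x; rewrite /Rm_energy; apply: (@cvg_sumr _ _ _ (nbhs x)) => m.
  apply: cvgMl_tmp.
  by apply: (@cvg_dotv _ _ _ (nbhs x)) => i;
    apply: (@cvg_mulmx_coord _ _ _ (nbhs x)) => j;
    exact: (solution_continuous a_sol aT).
set M := Rm_energy Rm s (a c) in cmax.
have VT : forall t, 0 <= t <= T -> V t <= lmin * delta ^+ 2.
  apply: (@sublevel_invariant _ (M / lmin)) => //.
    apply: le_trans (lmaxP a0) _; rewrite -sqr_enorm mulrC -ler_pdivlMr//.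
    have q0 : 0 <= lmin / lmax by rewrite divr_ge0.
    have := a0_le; rewrite -ler_sqr ?nnegrE ?enorm_ge0 ?mulr_ge0 ?sqrtr_ge0//.
    by rewrite exprMn (sqr_sqrtr q0) mulrA (mulrC (delta ^+ 2)).
  move=> t /andP[t0 tT] Vt; rewrite /dV.
  have tt : 0 <= t <= tau by rewrite (ltW t0) (le_trans (ltW tT)).
  set x := enorm (a t).
  have x0 : 0 <= x := enorm_ge0 _.
  have x2 : x ^+ 2 = dotv (a t) (a t) := sqr_enorm _.
  have [Vmin Vmax] := (lminP (a t), lmaxP (a t)).
  rewrite -/(V t) -x2 in Vmin Vmax.
  (* Here [lmin delta^2 < V <= lmax |a|^2]. The resulting bound [delta sqrt (lmin / lmax)] is
     weakened to the ratio itself, which is the form that the input bound matches. *)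
  have xge : delta * (lmin / lmax) <= x.
    rewrite -ler_sqr ?nnegrE ?mulr_ge0 ?invr_ge0//.
    apply: (@le_trans _ _ (delta ^+ 2 * (lmin / lmax))).
      rewrite exprMn ler_wpM2l ?sqr_ge0// expr2 ler_piMr ?divr_ge0//.
      by rewrite ler_pdivrMr// mul1r.
    rewrite mulrA ler_pdivrMr// (mulrC _ lmin) (mulrC _ lmax).
    exact: le_trans (ltW Vt) Vmax.
  have nuf : nu * enorm (f t) <= eps * x.
    (* For [nu = 0] the input bound is a division by zero, but the forcing term vanishes. *)
    have [nu0|nu0] := eqVneq nu 0; first by rewrite nu0 mul0r mulr_ge0.
    apply: (@le_trans _ _ (eps * (delta * (lmin / lmax)))).
      apply: le_trans (ler_wpM2l nu_ge0 (f_le tt)) _.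
      rewrite le_eqVlt; apply/orP; left; apply/eqP; field.
      by rewrite nu0 (gt_eqF lmax_gt0).
    by rewrite ler_pM2l.
  apply: le_trans (lyapunov (a t) (f t)) _.
  rewrite -x2 -/x.
  have E0 : 0 <= Rm_energy Rm s (a t) by exact: Rm_energy_ge0.
  have EM : Rm_energy Rm s (a t) <= M by apply: cmax; rewrite in_itv/= !ltW.
  have dx : x ^+ 2 - delta ^+ 2 <= (V t - lmin * delta ^+ 2) / lmin.
    by rewrite ler_pdivlMr//; lra.
  have neg : - eps * x ^+ 2 + nu * x * enorm (f t) <= 0.
    have -> : - eps * x ^+ 2 + nu * x * enorm (f t) = x * (nu * enorm (f t) - eps * x).
      by ring.
    by rewrite mulr_ge0_le0// subr_le0.
  have h1 := ler_wpM2r E0 dx.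
  have d0 : 0 <= (V t - lmin * delta ^+ 2) / lmin.
    by rewrite divr_ge0// subr_ge0 ltW.
  have h2 := ler_wpM2l d0 EM.
  have -> : M / lmin * (V t - lmin * delta ^+ 2) = (V t - lmin * delta ^+ 2) / lmin * M.
    by ring.
  by lra.
move=> t tT; rewrite enorm_le// -(ler_pM2l lmin_gt0).
exact: le_trans (lminP _) (VT t tT).
Qed.

Lemma solution_integrable_tau : integrable_until L Rm tau f a tau.
Proof.
apply: (solution_integrable f_cont a_sol tau_ge0 (ltW delta_gt0) f_le).
exact: solution_le_delta_until.
Qed.

Lemma solution_le_delta (t : R) : 0 <= t <= tau -> enorm (a t) <= delta.
Proof. exact: solution_le_delta_until solution_integrable_tau t. Qed.

Lemma dV_le (t : R) : 0 <= t <= tau ->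
  dV t <= - eps * enorm (a t) ^+ 2 + nu * enorm (a t) * enorm (f t).
Proof.
move=> tt; apply: le_trans (lyapunov (a t) (f t)) _.
rewrite sqr_enorm gerDl mulr_le0_ge0 ?Rm_energy_ge0// subr_le0.
by rewrite -enorm_le// solution_le_delta.
Qed.

Let sqrt_ratio_ge0 : 0 <= Num.sqrt (lmax / lmin). Proof. exact: sqrtr_ge0. Qed.

Lemma sqrt_ratio_le : Num.sqrt (lmax / lmin) <= lmax / lmin.
Proof.
have q1 : 1 <= lmax / lmin by rewrite ler_pdivlMr// mul1r.
have q0 : 0 <= lmax / lmin := le_trans ler01 q1.
rewrite -{2}(sqr_sqrtr q0) expr2 ler_peMr//.
by rewrite -sqrtr1 ler_sqrt// (lt_le_trans ltr01).
Qed.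

(** With [y = nu F / eps], above the level [lmax max(|a0|, y)^2] one has [|a| >= y], hence
    [V' <= 0], and the sublevel set is invariant. The maximum is then replaced by the sum, and
    [sqrt (lmax / lmin)] by [lmax / lmin] in the input term. *)
Lemma solution_le_sup (F : R) : (forall t, 0 <= t <= tau -> enorm (f t) <= F) ->
  forall t, 0 <= t <= tau ->
  enorm (a t) <= lmax * nu / (lmin * eps) * F + enorm a0 * Num.sqrt (lmax / lmin).
Proof.
move=> fF t tt.
have F0 : 0 <= F by apply: le_trans (enorm_ge0 (f t)) (fF t tt).
pose y := nu * F / eps.
have y0 : 0 <= y by rewrite divr_ge0 ?mulr_ge0.
have Vc : V t <= lmax * Num.max (enorm a0) y ^+ 2.
  apply: (@sublevel_invariant _ 0 tau) tt => //; first exact: solution_integrable_tau.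
    apply: le_trans (lmaxP a0) _; rewrite -sqr_enorm ler_pM2l//.
    by rewrite ler_sqr ?nnegrE ?le_max ?enorm_ge0 ?lexx.
  move=> u /andP[u0 utau] Vu; rewrite mul0r.
  have uu : 0 <= u <= tau by rewrite !ltW.
  apply: le_trans (dV_le uu) _.
  have yx : y <= enorm (a u).
    rewrite -ler_sqr ?nnegrE ?enorm_ge0// -(ler_pM2l lmax_gt0).
    apply: (@le_trans _ _ (V u)); last by rewrite sqr_enorm; exact: lmaxP.
    apply: le_trans (ltW Vu); rewrite ler_pM2l// ler_sqr ?nnegrE ?le_max ?lexx ?orbT//.
    by rewrite y0 orbT.
  have := ler_wpM2l nu_ge0 (fF u uu).
  move: yx; rewrite /y ler_pdivrMr// => yx nf.
  have -> : - eps * enorm (a u) ^+ 2 + nu * enorm (a u) * enorm (f u) =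
      enorm (a u) * (nu * enorm (f u) - enorm (a u) * eps) by ring.
  by rewrite mulr_ge0_le0 ?enorm_ge0// subr_le0 (le_trans nf).
have m0 : 0 <= Num.max (enorm a0) y by rewrite le_max enorm_ge0.
have : enorm (a t) <= Num.sqrt (lmax / lmin) * Num.max (enorm a0) y.
  rewrite enorm_le ?mulr_ge0// exprMn sqr_sqrtr ?divr_ge0//.
  rewrite -(ler_pM2l lmin_gt0) (le_trans (lminP _))// (le_trans Vc)//.
  by rewrite le_eqVlt; apply/orP; left; apply/eqP; field; rewrite gt_eqF.
move/le_trans; apply.
have -> : lmax * nu / (lmin * eps) * F = lmax / lmin * y.
  by rewrite /y; field; rewrite !gt_eqF.
have q0 : 0 <= lmax / lmin by rewrite divr_ge0.
rewrite maxr_pMr//; rewrite ge_max (mulrC (enorm a0)); apply/andP; split.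
  by rewrite lerDr mulr_ge0.
by rewrite ler_wpDr ?mulr_ge0 ?enorm_ge0// ler_wpM2r// sqrt_ratio_le.
Qed.

(** * The bound for finite exponents *)

Section Lp.
Local Notation mu := (@lebesgue_measure R).
Variable p : R.
Hypothesis p_ge1 : 1 <= p.

Let p_gt0 : 0 < p. Proof. exact: lt_le_trans p_ge1. Qed.
Let p_ge0 : 0 <= p. Proof. exact: ltW. Qed.
Let pB1_ge0 : 0 <= p - 1. Proof. by rewrite subr_ge0. Qed.

Let r := lmin * eps * delta / (lmax * nu).
(** [alpha] and [k] are the decay rate and the input gain in [U' <= - alpha U + k |f|] for
    [U = sqrt V]; the final gain is [k / alpha] divided by [sqrt lmin]. *)
Let alpha := eps / (2 * lmax).
Let k := nu / (2 * Num.sqrt lmin).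
Let alpha_gt0 : 0 < alpha. Proof. by rewrite divr_gt0// mulr_gt0. Qed.
Let alpha_ge0 : 0 <= alpha. Proof. exact: ltW. Qed.
Let slmin_gt0 : 0 < Num.sqrt lmin. Proof. by rewrite sqrtr_gt0. Qed.
Let k_ge0 : 0 <= k. Proof. by rewrite divr_ge0// mulr_ge0// ltW. Qed.

Let enorm_f_measurable : measurable_fun `[0, tau] (fun t => enorm (f t)).
Proof. by apply: measurable_enorm => i; exact: input_measurable f_cont i. Qed.

Let enorm_a_measurable : measurable_fun `[0, tau] (fun t => enorm (a t)).
Proof. by apply: measurable_enorm => i; exact: solution_measurable a_sol i. Qed.

Lemma input_powR_integrable :
  mu.-integrable `[0, tau] (EFin \o (fun t => enorm (f t) `^ p)).
Proof.
apply: (@bounded_powR_integrable _ _ _ r) => // t tt.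
by rewrite enorm_ge0 f_le.
Qed.

Lemma solution_powR_integrable :
  mu.-integrable `[0, tau] (EFin \o (fun t => enorm (a t) `^ p)).
Proof.
apply: (@bounded_powR_integrable _ _ _ delta) => // t tt.
by rewrite enorm_ge0 solution_le_delta.
Qed.

Let Nf := (\int[mu]_(t in `[0, tau]) (enorm (f t) `^ p)) `^ p^-1.
Let Na := (\int[mu]_(t in `[0, tau]) (enorm (a t) `^ p)) `^ p^-1.
(** The L_p norm of the constant 1 on [[0, tau]], through which the regularization error enters. *)
Let N1 := (\int[mu]_(t in `[0, tau]) (1 `^ p : R)) `^ p^-1.

(* [sqrt V] need not be differentiable where [V] vanishes. *)
Section Regularized.
Variable eta : R.
Hypothesis eta_gt0 : 0 < eta.

Let U (t : R) : R := Num.sqrt (V t + eta ^+ 2).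
Let dU (t : R) : R := (2 * U t)^-1 * dV t.

Let V_ge0 t : 0 <= V t.
Proof. by rewrite (le_trans _ (lminP _))// mulr_ge0// dotv_ge0. Qed.

Let W_gt0 t : 0 < V t + eta ^+ 2.
Proof. by rewrite ltr_wpDl// exprn_gt0. Qed.

Let sqrU t : U t ^+ 2 = V t + eta ^+ 2.
Proof. by rewrite sqr_sqrtr// ltW. Qed.

Let U_gt0 t : 0 < U t. Proof. by rewrite sqrtr_gt0. Qed.

Let eta_ge0 : 0 <= eta. Proof. exact: ltW. Qed.
Let U_ge0 t : 0 <= U t. Proof. exact: ltW. Qed.

Let eta_le_U t : eta <= U t.
Proof. by rewrite -ler_sqr ?nnegrE// sqrU lerDr. Qed.

Let U_cont : {within `[0, tau], continuous U}.
Proof.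
move=> x; apply: (@continuous_cvg _ _ _ (nbhs x) _ _ Num.sqrt).
  exact: sqrt_continuous.
apply: cvgD; last exact: cvg_cst.
exact: (solution_quad_continuous a_sol solution_integrable_tau).
Qed.

Let U_measurable : measurable_fun `[0, tau] U.
Proof. exact: subspace_continuous_measurable_fun. Qed.

Let U_is_derive (t : R) : 0 < t < tau -> t \notin sf -> is_derive t 1 U (dU t).
Proof.
move=> tt ts; apply: (@is_derive1_comp _ Num.sqrt (fun t => V t + eta ^+ 2)).
  exact: is_derive1_sqrt.
rewrite -[dV t]addr0; apply: is_deriveD.
exact: V_is_derive solution_integrable_tau tt ts.
Qed.

Let enorm_a_le_U (t : R) : enorm (a t) <= (Num.sqrt lmin)^-1 * U t.
Proof.
rewrite enorm_le ?mulr_ge0 ?invr_ge0 ?sqrtr_ge0// exprMn sqrU exprVn sqr_sqrtr//.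
by rewrite mulrC ler_pdivlMr// mulrC (le_trans (lminP _))// lerDl sqr_ge0.
Qed.

(** The bound on [V'] is divided by [2 U], using [U^2 - eta^2 <= lmax |a|^2] and
    [|a| <= U / sqrt lmin]. The excess [eta^2] is at most [eta U], whence the term [alpha * eta]. *)
Let dU_le (t : R) : 0 <= t <= tau ->
  dU t <= - alpha * U t + (alpha * eta + k * enorm (f t)).
Proof.
move=> tt; rewrite /dU mulrC ler_pdivrMr ?mulr_gt0//.
apply: le_trans (dV_le tt) _.
set x := enorm (a t); set y := enorm (f t).
have y0 : 0 <= y := enorm_ge0 _.
have h1 : 2 * alpha * (U t ^+ 2 - eta ^+ 2) <= eps * x ^+ 2.
  rewrite sqrU addrK (_ : 2 * alpha = eps / lmax); last first.
    by rewrite /alpha; field; rewrite gt_eqF.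
  by rewrite -mulrA ler_pM2l// ler_pdivrMl// /x sqr_enorm; exact: lmaxP.
have h2 : eta ^+ 2 <= eta * U t by rewrite expr2 ler_pM2l.
have h2' : 2 * alpha * eta ^+ 2 <= 2 * alpha * (eta * U t).
  by rewrite ler_pM2l// mulr_gt0.
have h3 : nu * x * y <= 2 * k * U t * y.
  apply: ler_wpM2r => //; rewrite (_ : 2 * k = nu / Num.sqrt lmin); last first.
    by rewrite /k; field; rewrite gt_eqF.
  by rewrite -mulrA ler_wpM2l// enorm_a_le_U.
by lra.
Qed.

Let U_bounded : exists M : R, forall t, 0 <= t <= tau -> U t <= M.
Proof.
have [c _ cmax] := EVT_max tau_ge0 U_cont.
by exists (U c) => t tt; apply: cmax; rewrite in_itv.
Qed.

Let U_powR_integrable (q : R) : 0 <= q ->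
  mu.-integrable `[0, tau] (EFin \o (fun t => U t `^ q)).
Proof.
move=> q0; have [M UM] := U_bounded.
by apply: (@bounded_powR_integrable _ _ _ M) => // t tt; rewrite U_ge0 UM.
Qed.

Let fU_integrable :
  mu.-integrable `[0, tau] (EFin \o (fun t => enorm (f t) * U t `^ (p - 1))).
Proof.
have [M UM] := U_bounded.
apply: (@bounded_itv_integrable _ _ _ (r * M `^ (p - 1))).
  apply: measurable_funM => //.
  exact: (measurableT_comp (measurable_powR (p - 1)) U_measurable).
move=> t tt; rewrite ger0_norm ?mulr_ge0 ?powR_ge0 ?enorm_ge0//.
apply: ler_pM; rewrite ?enorm_ge0 ?powR_ge0 ?f_le//.
exact: (powR_le pB1_ge0 (U_ge0 t) (UM _ tt)).
Qed.

(** Minus [U^(p-1)] times the right-hand side of [dU_le], so that [(U^p)' + p psi <= 0]. *)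
Let psi (t : R) : R :=
  alpha * U t `^ p - (alpha * eta * U t `^ (p - 1) +
                      k * (enorm (f t) * U t `^ (p - 1))).

Let psi_tail_integrable : mu.-integrable `[0, tau]
  (EFin \o (fun t => alpha * eta * U t `^ (p - 1) +
                      k * (enorm (f t) * U t `^ (p - 1)))).
Proof.
exact: (integrableD _ (integrable_itvZl (alpha * eta) (U_powR_integrable pB1_ge0))
                      (integrable_itvZl k fU_integrable)).
Qed.

Let psi_integrable : mu.-integrable `[0, tau] (EFin \o psi).
Proof.
exact: (integrableB _ (integrable_itvZl alpha (U_powR_integrable p_ge0))
                      psi_tail_integrable).
Qed.

(** [U^p] plus the primitive of [p psi] is nonincreasing; its value at 0 is [U(0)^p], and
    [U(tau)^p >= 0] is dropped. *)
Let U_energy : \int[mu]_(t in `[0, tau]) (p * psi t) <= U 0 `^ p.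
Proof.
pose H t := U t `^ p + \int[mu]_(x in `[0, t]) (p * psi x).
have ipsi := integrable_itvZl p psi_integrable.
have H0 : H 0 = U 0 `^ p by rewrite /H set_itv1 Rintegral_set1 addr0.
have Htau : \int[mu]_(t in `[0, tau]) (p * psi t) <= H tau.
  by rewrite /H lerDr powR_ge0.
apply: le_trans Htau _; rewrite -H0.
apply: (@le0_derive_off_finite_le _ _ (fun t => p * U t `^ (p - 1) * dU t + p * psi t) sf) => //.
  move=> x; apply: cvgD.
    by apply: (@cvg_powR _ _ (nbhs x)) => //; exact: U_cont.
  exact: (parameterized_integral_continuous tau_ge0 ipsi).
move=> t tt ts; split; last first.
  have tt' : 0 <= t <= tau by case/andP : tt => ? ?; rewrite !ltW.
  have := ler_wpM2l (powR_ge0 (U t) (p - 1)) (dU_le tt').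
  rewrite -mulrA -mulrDr pmulr_rle0// /psi -(mulr_powRB1 (U_ge0 t) p_gt0).
  move: (dU t) (U t `^ (p - 1)) (U t) (enorm (f t)) alpha k => d Y u y al c h.
  by lra.
have cU : {for t, continuous U}.
  apply: differentiable_continuous; apply/derivable1_diffP.
  by case: (U_is_derive tt ts).
apply: is_deriveD.
  apply: (@is_derive1_comp _ (fun y => y `^ p) U); last exact: U_is_derive.
  exact: is_derive1_powR.
apply: (is_derive_primitive ipsi tt).
apply: cvgMl_tmp; apply: cvgB; first by apply: cvgMl_tmp; exact: (@cvg_powR _ _ (nbhs t)).
apply: cvgD; first by apply: cvgMl_tmp; exact: (@cvg_powR _ _ (nbhs t)).
apply: cvgMl_tmp; apply: cvgM; last exact: (@cvg_powR _ _ (nbhs t)).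
by apply: (@cvg_enorm _ _ _ (nbhs t)) => i; exact: f_cont.
Qed.

Let X := (\int[mu]_(t in `[0, tau]) (U t `^ p)) `^ p^-1.

Let intU_ge0 : 0 <= \int[mu]_(t in `[0, tau]) (U t `^ p).
Proof. by apply: Rintegral_ge0 => t _; exact: powR_ge0. Qed.

Let XpE : X `^ p = \int[mu]_(t in `[0, tau]) (U t `^ p).
Proof. by rewrite /X -powRrM mulVf ?gt_eqF// powRr1. Qed.

Let rho := (2 * lmax / (eps * p)) `^ p^-1.

(** Hoelder bounds the integrals of [U^(p-1)] against 1 and against [|f|] by [N1] and [Nf] times
    [X^(p-1)]. Dividing [U_energy] by [alpha p], with [1 / (alpha p) = rho^p], gives the hypothesis
    of [le_add_of_powR_le]. *)
Let X_le : X <= eta * N1 + k / alpha * Nf + U 0 * rho.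
Proof.
have N1_ge0 : 0 <= N1 := powR_ge0 _ _.
have Nf_ge0 : 0 <= Nf := powR_ge0 _ _.
have A_ge0 : 0 <= eta * N1 + k / alpha * Nf.
  exact: (addr_ge0 (mulr_ge0 eta_ge0 N1_ge0) (mulr_ge0 (divr_ge0 k_ge0 alpha_ge0) Nf_ge0)).
have rho_ge0 : 0 <= rho := powR_ge0 _ _.
have X_ge0 : 0 <= X := powR_ge0 _ _.
have rhop : rho `^ p = 2 * lmax / (eps * p).
  by rewrite /rho -powRrM mulVf ?gt_eqF// powRr1// divr_ge0 ?mulr_ge0.
apply: (le_add_of_powR_le A_ge0 (mulr_ge0 (U_ge0 0) rho_ge0) X_ge0 p_ge1).
rewrite (powRM _ (U_ge0 0) rho_ge0) rhop.
have enf_ge0 t : 0 <= t <= tau -> 0 <= enorm (f t) by move=> _; exact: enorm_ge0.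
have U_pos t : 0 <= t <= tau -> 0 <= U t by move=> _; exact: U_ge0.
have hf : \int[mu]_(t in `[0, tau]) (enorm (f t) * U t `^ (p - 1)) <= Nf * X `^ (p - 1).
  exact: (hoelder_itv p_ge1 enorm_f_measurable U_measurable enf_ge0 U_pos
            input_powR_integrable (U_powR_integrable p_ge0) fU_integrable).
have oneU : (fun t => 1 * U t `^ (p - 1)) = (fun t => U t `^ (p - 1)).
  by apply/funext => t; rewrite mul1r.
have h1 : \int[mu]_(t in `[0, tau]) (U t `^ (p - 1)) <= N1 * X `^ (p - 1).
  have i1 : mu.-integrable `[0, tau] (EFin \o (fun t : R => (1 : R) `^ p)).
    apply: (@bounded_powR_integrable _ (cst 1) _ 1) => // t _.
    by rewrite ler01 lexx.
  have i2 : mu.-integrable `[0, tau] (EFin \o (fun t => 1 * U t `^ (p - 1))).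
    by rewrite oneU; exact: U_powR_integrable.
  have := @hoelder_itv _ tau p (cst 1) U p_ge1 (measurable_cst _) U_measurable
    (fun _ _ => ler01) U_pos i1 (U_powR_integrable p_ge0) i2.
  by rewrite oneU.
have := U_energy.
rewrite RintegralZl// RintegralB//; last first.
  by apply: integrable_itvZl; apply: U_powR_integrable; exact: ltW.
rewrite RintegralD//; last 2 first.
  by apply: integrable_itvZl; exact: U_powR_integrable.
  exact: integrable_itvZl.
rewrite !RintegralZl//; last 2 first.
  exact: U_powR_integrable.
  by apply: U_powR_integrable; exact: ltW.
rewrite -XpE => h.
have h1' := ler_wpM2l (mulr_ge0 (ltW alpha_gt0) (ltW eta_gt0)) h1.
have hf' := ler_wpM2l k_ge0 hf.
have hh : alpha * X `^ p <=
    U 0 `^ p / p + alpha * eta * (N1 * X `^ (p - 1)) + k * (Nf * X `^ (p - 1)).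
  move: h; rewrite mulrC -ler_pdivlMr// lerBlDr => /le_trans; apply.
  by rewrite -addrA lerD2l (lerD h1' hf').
rewrite -(ler_pM2l alpha_gt0); apply: le_trans hh _.
rewrite le_eqVlt; apply/orP; left; apply/eqP; rewrite /alpha; field.
by rewrite !gt_eqF.
Qed.

Let U0_le : U 0 <= Num.sqrt lmax * enorm a0 + eta.
Proof.
have s0 : 0 <= Num.sqrt lmax * enorm a0 by rewrite mulr_ge0 ?sqrtr_ge0 ?enorm_ge0.
rewrite -ler_sqr ?nnegrE ?addr_ge0// sqrU V0E.
apply: (@le_trans _ _ ((Num.sqrt lmax * enorm a0) ^+ 2 + eta ^+ 2)).
  by rewrite lerD2r exprMn sqr_sqrtr// sqr_enorm; exact: lmaxP.
by rewrite sqrrD lerD2r lerDl mulrn_wge0// mulr_ge0.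
Qed.

(** The pointwise bound [|a| <= U / sqrt lmin] transfers [X_le] to [a], and [U0_le] introduces
    [|a0|]; all that depends on [eta] is collected in one linear term. *)
Lemma Lp_regularized_le : Na <= lmax * nu / (lmin * eps) * Nf
  + enorm a0 * Num.sqrt (lmax / lmin) * rho + eta * ((Num.sqrt lmin)^-1 * (N1 + rho)).
Proof.
have c0 : 0 <= (Num.sqrt lmin)^-1 by rewrite invr_ge0 ltW.
have rho0 : 0 <= rho := powR_ge0 _ _.
have X_ge0 : 0 <= X := powR_ge0 _ _.
apply: (@le_trans _ _ ((Num.sqrt lmin)^-1 * X)).
  have cX : 0 <= (Num.sqrt lmin)^-1 * X := mulr_ge0 c0 X_ge0.
  have -> : (Num.sqrt lmin)^-1 * X = (((Num.sqrt lmin)^-1 * X) `^ p) `^ p^-1.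
    by rewrite -powRrM divff ?gt_eqF// powRr1.
  have pV_ge0 : 0 <= p^-1 by rewrite invr_ge0.
  have Ia_ge0 : 0 <= \int[mu]_(t in `[0, tau]) (enorm (a t) `^ p).
    by apply: Rintegral_ge0 => t _; exact: powR_ge0.
  apply: (powR_le pV_ge0 Ia_ge0).
  have iU := U_powR_integrable p_ge0.
  rewrite (powRM _ c0 X_ge0) XpE -(RintegralZl _ _ iU)//.
  apply: (le_Rintegral _ solution_powR_integrable (integrable_itvZl _ iU)) => // t _.
  rewrite -(powRM _ c0 (U_ge0 t)).
  exact: (powR_le p_ge0 (enorm_ge0 _) (enorm_a_le_U t)).
have h := ler_wpM2r rho0 U0_le.
have := ler_wpM2l c0 (le_trans X_le (lerD (lexx _) h)).
move=> /le_trans; apply; rewrite le_eqVlt; apply/orP; left; apply/eqP.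
have -> : Num.sqrt (lmax / lmin) = Num.sqrt lmax / Num.sqrt lmin.
  by rewrite sqrtrM// sqrtrV.
have -> : lmax * nu / (lmin * eps) = (Num.sqrt lmin)^-1 * (k / alpha).
  rewrite /k /alpha -{1}(sqr_sqrtr lmin_ge0).
  by field; rewrite !gt_eqF.
by field; rewrite !gt_eqF.
Qed.

End Regularized.

(** The limit [eta -> 0]: the excess is [eta * C] with [C] independent of [eta], and
    [eta = e / (C + 1)] keeps it below [e]. *)
Lemma solution_Lp_le : Na <= lmax * nu / (lmin * eps) * Nf
  + enorm a0 * Num.sqrt (lmax / lmin) * (2 * lmax / (eps * p)) `^ p^-1.
Proof.
set C := (Num.sqrt lmin)^-1 * (N1 + (2 * lmax / (eps * p)) `^ p^-1).
have C0 : 0 <= C by rewrite mulr_ge0 ?invr_ge0 ?addr_ge0 ?powR_ge0 ?sqrtr_ge0.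
apply/ler_addgt0Pr => e e0.
have C1 : 0 < C + 1 by rewrite ltr_wpDl.
apply: le_trans (@Lp_regularized_le (e / (C + 1)) _) _; first by rewrite divr_gt0.
by rewrite lerD2l mulrAC ler_pdivrMr// ler_pM2l// lerDl.
Qed.

End Lp.

End Stability.

(** * Passage to the eigenvalues of [P] and the norms of truncated signals *)

Lemma piecewise_continuous_trunc (R : realType) (n : nat) (tau : R) (f : R -> 'cV[R]_n) :
  piecewise_continuous (trunc tau f) ->
  exists sf : seq R, forall t : R, 0 < t < tau -> t \notin sf ->
    forall i, {for t, continuous (fun u => f u i 0)}.
Proof.
move=> pf; have [tau0|tau0] := leP tau 0.
  by exists [::] => t /andP[t0 tt]; have := lt_trans t0 tt; rewrite ltNge tau0.
have [sf [cf _]] := pf tau tau0; exists sf => t tt ts i.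
have ct : {for t, continuous (fun u => trunc tau f u i 0)}.
  apply: (@continuous_comp _ _ _ (trunc tau f) (fun x : 'cV[R]_n => x i 0)).
    exact: cf.
  exact: coord_continuous.
have [_ ttau] := andP tt.
rewrite /prop_for /continuous_at.
have <- : trunc tau f t i 0 = f t i 0 by rewrite /trunc ltW.
(* As [t < tau], the input and its truncation agree near [t]. *)
apply: cvg_trans ct; apply: near_eq_cvg; near=> u.
have : u \in `]0, tau[ by near: u; apply: near_in_itvoo; rewrite in_itv.
by rewrite in_itv/= => /andP[_ /ltW utau]; rewrite /trunc utau.
Unshelve. all: by end_near. Qed.

Unset Implicit Arguments.

Theorem theorem2 (R : realType) (n : nat) (L : 'M[R]_n) (Rm : 'I_n -> 'M[R]_n)
  (nv : 'cV[R]_n) (delta : R) (P : 'M[R]_n) (eps : R) (s : 'I_n -> R)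
  (mu0 : R) (mu : 'I_n -> R) (kappa : 'I_n -> R) :
  (0 < n)%N ->
  hurwitz L ->
  (forall m, symmetric_mx (Rm m)) ->
  (forall a : 'cV[R]_n, dotv a (Ups Rm a) = 0) ->
  (forall a : 'cV[R]_n, dotv nv (Ups Rm a) = 0) ->
  0 < delta ->
  symmetric_mx P ->
  0 < eps ->
  (forall m, 0 <= s m) ->
  psd (P - eps%:M) ->
  nsd (block_mx
         (L^T *m P + P *m L + eps%:M
            + \sum_(m < n) (s m * delta ^+ 2) *: (Rm m *m Rm m))
         (P + mu0 *: 1%:M + \sum_(i < n) mu i *: (unitv i *m nv^T))
         (P + mu0 *: (1%:M)^T + \sum_(i < n) mu i *: (unitv i *m nv^T)^T)
         (- \sum_(m < n) s m *: (unitv m *m (unitv m)^T)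
            + \sum_(j < n) kappa j *: (unitv j *m nv^T + nv *m (unitv j)^T))) ->
  let lmin := lambda_min P in
  let lmax := lambda_max P in
  let r := lmin * eps * delta / (lmax * spec_norm (2 *: P)) in
  let gamma := lmax * spec_norm (2 *: P) / (lmin * eps) in
  forall a0 : 'cV[R]_n,
  enorm a0 <= delta * Num.sqrt (lmin / lmax) ->
  forall p : \bar R, (1 <= p)%E ->
  let beta := enorm a0 * Num.sqrt (lmax / lmin) * rho_const p lmax eps in
  forall (tau : R) (f : R -> 'cV[R]_n) (a : R -> 'cV[R]_n),
  0 <= tau ->
  in_Lpe p f ->
  (forall t, 0 <= t <= tau -> enorm (f t) <= r) ->
  is_solution L Rm f a0 tau a ->
  (forall t, 0 <= t <= tau -> enorm (a t) <= delta) /\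
  (Lp_norm p (trunc tau a) <= gamma%:E * Lp_norm p (trunc tau f) + beta%:E)%E.
Proof.
move=> n_gt0 _ Rm_sym dotv_Ups nv_Ups delta_gt0 P_sym eps_gt0 s_ge0 P_eps G_nsd.
move=> lmin lmax r gamma a0 a0_le p p1 beta tau f a tau_ge0 f_Lpe f_le a_sol.
have lmin_gt0 : 0 < lmin := lt_le_trans eps_gt0 (lambda_min_ge n_gt0 P_sym P_eps).
have lminP := lambda_min_le_dotv n_gt0 P_sym.
have lmaxP := dotv_le_lambda_max n_gt0 P_sym.
(* The two Rayleigh bounds are compared on an eigenvector, which exists because [n > 0]. *)
have lmin_le_lmax : lmin <= lmax.
  have [m Pm _] := rayleigh_max n_gt0 P_sym.
  have [x x0 _] := eigenvalue_cV P_sym Pm.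
  by rewrite -(ler_pM2r x0); exact: le_trans (lminP x) (lmaxP x).
have nu_ge0 : 0 <= spec_norm (2 *: P) := sqrtr_ge0 _.
have lyap := lyapunov_forced n_gt0 Rm_sym dotv_Ups nv_Ups P_sym s_ge0 G_nsd.
have [sf f_cont] := piecewise_continuous_trunc (f_Lpe tau tau_ge0).1.
split.
  exact: (solution_le_delta P_sym s_ge0 delta_gt0 eps_gt0 lmin_gt0 lmin_le_lmax
    lminP lmaxP nu_ge0 lyap tau_ge0 f_cont a_sol a0_le f_le).
have lmax_gt0 : 0 < lmax := lt_le_trans lmin_gt0 lmin_le_lmax.
have gamma_ge0 : 0 <= gamma.
  by rewrite divr_ge0 ?mulr_ge0 ?(ltW lmax_gt0) ?(ltW lmin_gt0) ?(ltW eps_gt0).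
rewrite /beta; case: p p1 f_Lpe beta => [p p1 f_Lpe|_ f_Lpe|//] beta.
  have p_ge1 : 1 <= p by rewrite -lee_fin.
  have p_gt0 : 0 < p := lt_le_trans ltr01 p_ge1.
  rewrite (Lp_norm_trunc p_gt0 (solution_powR_integrable P_sym s_ge0 delta_gt0 eps_gt0
    lmin_gt0 lmin_le_lmax lminP lmaxP nu_ge0 lyap tau_ge0 f_cont a_sol a0_le f_le p_ge1)).
  rewrite (Lp_norm_trunc p_gt0 (input_powR_integrable f_cont f_le p_ge1)).
  rewrite -EFinM -EFinD lee_fin.
  exact: (solution_Lp_le P_sym s_ge0 delta_gt0 eps_gt0 lmin_gt0 lmin_le_lmax
    lminP lmaxP nu_ge0 lyap tau_ge0 f_cont a_sol a0_le f_le p_ge1).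
(* For [p = +oo], membership in the extended space makes the norm of the truncated input a real [F],
   which bounds the input on [[0, tau]]. *)
have sup_ge t : 0 <= t -> ((enorm (trunc tau f t))%:E <= Lp_norm +oo (trunc tau f))%E.
  by move=> t0; apply: ereal_sup_ubound; exists t => //; rewrite /= in_itv/= t0.
have := (f_Lpe tau tau_ge0).2; move: sup_ge.
case: (Lp_norm +oo (trunc tau f)) => [F sup_ge _|//|/(_ _ (lexx 0))//].
rewrite -EFinM -EFinD mulr1.
have fF t : 0 <= t <= tau -> enorm (f t) <= F.
  by move=> /andP[t0 tt]; have := sup_ge t t0; rewrite /trunc tt lee_fin.
have aF := solution_le_sup P_sym s_ge0 delta_gt0 eps_gt0 lmin_gt0 lmin_le_lmax
    lminP lmaxP nu_ge0 lyap tau_ge0 f_cont a_sol a0_le f_le fF.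
apply: ge_ereal_sup => _ [t + <-]; rewrite /= in_itv/= andbT => t0.
rewrite lee_fin /trunc; case: ifPn => [tt|_]; first by apply: aF; rewrite t0.
(* Past [tau] the truncation vanishes, and only nonnegativity of the bound remains. *)
rewrite /enorm big1 ?sqrtr0; last by move=> i _; rewrite mxE expr0n.
have F_ge0 : 0 <= F by apply: le_trans (enorm_ge0 (f 0)) (fF 0 _); rewrite lexx.
exact: (addr_ge0 (mulr_ge0 gamma_ge0 F_ge0) (mulr_ge0 (enorm_ge0 _) (sqrtr_ge0 _))).
Qed.
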